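(* Every convex weakly o-minimal type of mixed kind is trivial.
   Context: $T$ is an arbitrary (possibly multi-sorted) complete first-order theory with monster model $\mathfrak C$; parameter sets $A$ are small. For $p\in S(A)$, $p(\mathfrak C)$ is its set of realizations; $X\subseteq p(\mathfrak C)^n$ is relatively $B$-definable if $X=\phi(\mathfrak C)\cap p(\mathfrak C)^n$ for some $L_B$-formula $\phi$, and relatively definable if it is so for some $B$. A weakly o-minimal pair over $A$ is $\mathbf p=(p,<)$ where $p\in S(A)$, $<$ is a relatively $A$-definable linear order on $p(\mathfrak C)$, and every relatively definable subset of $p(\mathfrak C)$ is a finite union of $<$-convex subsets of $p(\mathfrak C)$. A type $p\in S(A)$ is weakly o-minimal if $(p,<)$ is such a pair for some $<$. It is convex if, for some such pair $(p,<)$, there is $\theta\in p$ such that the formula relatively defining $<$ defines a linear order on $D=\theta(\mathfrak C)$ and $p(\mathfrak C)$ is a convex subset of $(D,<)$. For a weakly o-minimal pair $\mathbf p=(p,<)$ over $A$, $\mathbf p_r$ (respectively $\mathbf p_l$) is the global type consisting of all formulae $\phi(x)$ over $\mathfrak C$ such that $\phi(\mathfrak C)$ contains a final part (respectively, an initial part) of $(p(\mathfrak C),<)$; these are the global nonforking ($A$-invariant) extensions of $p$. A convex weakly o-minimal type $p$ is of mixed kind if exactly one of its global nonforking extensions $\mathbf p_l,\mathbf p_r$ is a definable type. For $a,b\models p$ write $a\triangleleft^{\mathbf p}b$ if $b\models(\mathbf p_r)_{\restriction Aa}$. A sequence $(a_i\mid i\in\omega)$ is Morley in $\mathbf p_r$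 over $A$ if $a_i\models(\mathbf p_r)_{\restriction Aa_{<i}}$ for all $i$. A weakly o-minimal type $p\in S(A)$ is trivial if for some (equivalently, every) weakly o-minimal pair $\mathbf p=(p,<)$ over $A$, every sequence $(a_i\mid i\in\omega)$ of realizations of $p$ with $a_i\triangleleft^{\mathbf p}a_j$ for all $i<j$ is a Morley sequence in $\mathbf p_r$ over $A$. *)

(* Defs.v *)
From mathcomp Require Import all_boot.
From mathcomp Require Import boolp classical_sets functions cardinality.

Set Implicit Arguments.
Unset Strict Implicit.
Unset Printing Implicit Defensive.

Local Open Scope classical_set_scope.
Local Open Scope card_scope.

(* Many-sorted first-order logic.  Variables are organised in sorted families
   [V : S -> Type] ([V s] is the set of variables of sort [s]), which need not
   be finite; a finite tuple of variables is a context [G : seq S], turned into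
   the family [var G]. *)

Section Families.
Variable S : Type.

Definition ext (V : S -> Type) (s : S) : S -> Type :=
  fun t => ((s = t) + V t)%type.

Fixpoint var (G : seq S) : S -> Type :=
  if G is s :: G' then ext (var G') s else fun=> void.

Definition fsum (V W : S -> Type) : S -> Type := fun s => (V s + W s)%type.

Definition assign (V M : S -> Type) := forall s, V s -> M s.

Definition tup (M : S -> Type) (G : seq S) := assign (var G) M.

Definition acons (V M : S -> Type) s (x : M s) (a : assign V M) :
    assign (ext V s) M :=
  fun t v => match v with
             | inl e => eq_rect s M x t e
             | inr v' => a t v'
             end.

Definition asum (V W M : S -> Type) (a : assign V M) (b : assign W M) :
    assign (fsum V W) M :=
  fun s v => match v with inl x => a s x | inr y => b s y end.

Definition fmap_ext (V W : S -> Type) (f : assign V W) s :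
    assign (ext V s) (ext W s) :=
  fun t v => match v with inl e => inl e | inr v' => inr (f t v') end.

Definition fmap_sumr (U V W : S -> Type) (f : assign V W) :
    assign (fsum U V) (fsum U W) :=
  fun s v => match v with inl x => inl x | inr y => inr (f s y) end.

End Families.

Record language := Language {
  srt : Type;
  fsym : Type;
  fdom : fsym -> seq srt;
  fcod : fsym -> srt;
  rsym : Type;
  rdom : rsym -> seq srt }.

Inductive term (L : language) (V : srt L -> Type) : srt L -> Type :=
| TVar s : V s -> term V s
| TFun (f : fsym L) :
    (forall s, var (fdom f) s -> term V s) -> term V (fcod f).

Inductive formula (L : language) (V : srt L -> Type) : Type :=
| FFalse : formula V
| FEq s : term V s -> term V s -> formula V
| FRel (r : rsym L) : (forall s, var (rdom r) s -> term V s) -> formula V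
| FImp : formula V -> formula V -> formula V
| FAll s : formula (ext V s) -> formula V.
Arguments FFalse {L V}.

Definition FNot (L : language) (V : srt L -> Type) (f : formula V) : formula V :=
  FImp f FFalse.

Fixpoint trename (L : language) (V W : srt L -> Type) (f : assign V W) s
    (t : term V s) : term W s :=
  match t with
  | TVar s v => TVar (f s v)
  | TFun g u => TFun (fun s v => trename f (u s v))
  end.

Fixpoint rename (L : language) (V W : srt L -> Type) (f : assign V W)
    (phi : formula V) : formula W :=
  match phi with
  | FFalse => FFalse
  | FEq s t u => FEq (trename f t) (trename f u)
  | FRel r u => FRel (fun s v => trename f (u s v))
  | FImp p q => FImp (rename f p) (rename f q)
  | FAll s p => FAll (rename (@fmap_ext _ _ _ f s) p)
  end.

Record structure (L : language) := Structure {
  carrier :> srt L -> Type;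
  funI : forall f : fsym L, tup carrier (fdom f) -> carrier (fcod f);
  relI : forall r : rsym L, tup carrier (rdom r) -> Prop }.

Section Semantics.
Variables (L : language) (M : structure L).

Fixpoint eval (V : srt L -> Type) (a : assign V M) s (t : term V s) : M s :=
  match t with
  | TVar s v => a s v
  | TFun f u => @funI L M f (fun s v => eval a (u s v))
  end.

Fixpoint sat (V : srt L -> Type) (a : assign V M) (phi : formula V) : Prop :=
  match phi with
  | FFalse => False
  | FEq s t u => eval a t = eval a u
  | FRel r u => @relI L M r (fun s v => eval a (u s v))
  | FImp p q => sat a p -> sat a q
  | FAll s p => forall x : M s, sat (acons x a) p
  end.

Record automorphism (g : forall s, M s -> M s) : Prop := Automorphism {
  aut_bij : forall s, bijective (g s);
  aut_fun : forall (f : fsym L) (a : tup M (fdom f)),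
    g _ (funI a) = funI (fun s v => g s (a s v));
  aut_rel : forall (r : rsym L) (a : tup M (rdom r)),
    relI a <-> relI (fun s v => g s (a s v)) }.

(* Parameter sets.  [lform A V] is the set of L_A-formulas with free variables
   in V: the elements of A are used as additional names. *)

Definition params := forall s, set (M s).

Definition allparams : params := fun s => setT.
Arguments allparams s : clear implicits.

Definition par (A : params) : srt L -> Type := fun s => {x : M s | A s x}.

Definition lform (A : params) (V : srt L -> Type) := formula (fsum V (par A)).

Definition asat (A : params) (V : srt L -> Type) (a : assign V M)
    (phi : lform A V) : Prop :=
  sat (asum a (fun s (x : par A s) => sval x)) phi.

Definition solutions (A : params) (G : seq (srt L)) (phi : lform A (var G)) :
  set (tup M G) := [set a | asat a phi].

Definition toglobal (A : params) (V : srt L -> Type) (phi : lform A V) :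
    lform allparams V :=
  rename (fmap_sumr (fun s (x : par A s) => exist (allparams s) (sval x) I)) phi.

(* phi(x, b) for an L-formula phi(x, y), x being the variables of V and y those
   of W. *)
Definition instantiate (V W : srt L -> Type) (phi : formula (fsum V W))
    (b : assign W M) : lform allparams V :=
  rename (fmap_sumr (fun s (y : W s) => exist (allparams s) (b s y) I)) phi.

Definition finsat (A : params) (G : seq (srt L)) (p : set (lform A (var G))) :=
  forall F, finite_set F -> F `<=` p ->
    exists a : tup M G, forall phi, F phi -> asat a phi.

Definition realizations (A : params) (G : seq (srt L))
    (p : set (lform A (var G))) : set (tup M G) :=
  [set a | forall phi, p phi -> asat a phi].

(* p \in S(A); finite satisfiability in M amounts to consistency with the elementary
   diagram of A. *)
Definition complete_type (A : params) (G : seq (srt L))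
    (p : set (lform A (var G))) :=
  finsat p /\ forall phi, p phi \/ p (FNot phi).

Definition card_lt (T K : Type) : Prop :=
  ([set: T] #<= [set: K]) /\ ~ ([set: K] #<= [set: T]).

Definition small (K : Type) (V : srt L -> Type) := card_lt {s & V s} K.

(* A kappa-saturated, strongly kappa-homogeneous structure, where kappa = |K|
   is greater than |L| (the number of L-formulas, so kappa is uncountable).
   The ambient complete theory is Th(M). *)
Record monster (K : Type) : Prop := Monster {
  monster_lang : card_lt {G : seq (srt L) & formula (var G)} K;
  monster_sat : forall (A : params), small K (par A) ->
    forall (G : seq (srt L)) (p : set (lform A (var G))),
      finsat p -> realizations p !=set0;
  monster_hom : forall (V : srt L -> Type), small K V ->
    forall a b : assign V M,
      (forall phi : formula V, sat a phi <-> sat b phi) ->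
      exists2 g, automorphism g & forall s v, g s (a s v) = b s v }.

Definition definable (G : seq (srt L)) (X : set (tup M G)) :=
  exists (B : params) (psi : lform B (var G)), X = solutions psi.

Definition definable_type (G : seq (srt L)) (q : set (lform allparams (var G))) :=
  forall (D : seq (srt L)) (phi : formula (fsum (var G) (var D))),
    definable [set b : tup M D | q (instantiate phi b)].

Definition restrict (G : seq (srt L)) (q : set (lform allparams (var G)))
    (B : params) : set (lform B (var G)) :=
  [set phi | q (toglobal phi)].

Definition add_params (A : params) (G : seq (srt L)) (E : set (tup M G)) :
    params :=
  fun s => A s `|` [set x | exists2 a : tup M G, E a & exists v, a s v = x].

End Semantics.
Arguments allparams {L} M s.
Arguments restrict {L M G} q B phi.

Section Orders.
Variable T : Type.
Implicit Types (lt : T -> T -> Prop) (E C : set T).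

Definition linear_order_on E lt :=
  [/\ forall x, E x -> ~ lt x x,
      forall x y z, E x -> E y -> E z -> lt x y -> lt y z -> lt x z
    & forall x y, E x -> E y -> [\/ lt x y, x = y | lt y x]].

Definition convex_in E lt C :=
  C `<=` E /\ forall x y z, C x -> C z -> E y -> lt x y -> lt y z -> C y.

(* Final and initial parts are nonempty. *)
Definition final_part E lt C :=
  [/\ C `<=` E, C !=set0 & forall x y, C x -> E y -> lt x y -> C y].

Definition initial_part E lt C :=
  [/\ C `<=` E, C !=set0 & forall x y, C x -> E y -> lt y x -> C y].

End Orders.

Section WeaklyOMinimal.
Variables (L : language) (M : structure L) (A : params M) (G : seq (srt L)).
Variable p : set (lform A (var G)).
Implicit Types (lt : tup M G -> tup M G -> Prop) (X : set (tup M G)).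

Local Notation "'pC'" := (realizations p).

Definition relatively_definable X :=
  exists (B : params M) (phi : lform B (var G)), X = solutions phi `&` pC.

Definition rel_of (la : lform A (fsum (var G) (var G))) :
    tup M G -> tup M G -> Prop :=
  fun a b => asat (asum a b) la.

(* Only the restriction of [lt] to p(C) is meaningful. *)
Definition relatively_defines (la : lform A (fsum (var G) (var G))) lt :=
  forall a b, pC a -> pC b -> (lt a b <-> rel_of la a b).

Definition weakly_o_minimal_pair lt :=
  [/\ exists la, relatively_defines la lt,
      linear_order_on pC lt
    & forall X, relatively_definable X ->
        exists (n : nat) (C : 'I_n -> set (tup M G)),
          (forall i, convex_in pC lt (C i)) /\ X = \bigcup_i C i].

Definition weakly_o_minimal := exists lt, weakly_o_minimal_pair lt.

Definition convex_type :=
  exists lt, weakly_o_minimal_pair lt /\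
    exists la, relatively_defines la lt /\
      exists theta, [/\ p theta,
        linear_order_on (solutions theta) (rel_of la)
      & convex_in (solutions theta) (rel_of la) pC].

Definition right_type lt : set (lform (allparams M) (var G)) :=
  [set phi | exists2 F, final_part pC lt F & F `<=` solutions phi].

Definition left_type lt : set (lform (allparams M) (var G)) :=
  [set phi | exists2 F, initial_part pC lt F & F `<=` solutions phi].

Definition mixed_kind :=
  exists lt, weakly_o_minimal_pair lt /\
    (definable_type (left_type lt) /\ ~ definable_type (right_type lt) \/
     ~ definable_type (left_type lt) /\ definable_type (right_type lt)).

Definition triangle lt (a b : tup M G) :=
  [/\ pC a, pC b &
      realizations (restrict (right_type lt) (add_params A [set a])) b].

Definition morley lt (a : nat -> tup M G) :=
  forall i, realizations
    (restrict (right_type lt) (add_params A [set a j | j in `I_i])) (a i).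

Definition trivial_type :=
  exists lt, weakly_o_minimal_pair lt /\
    forall a : nat -> tup M G,
      (forall i, pC (a i)) ->
      (forall i j, (i < j)%N -> triangle lt (a i) (a j)) ->
      morley lt a.

End WeaklyOMinimal.

(* Main.v *)
Require Import Defs.
From mathcomp Require Import all_boot.
From mathcomp Require Import boolp classical_sets functions cardinality.

(** The left type may be assumed definable and the right type not (reverse the
order otherwise); then P = p(C) is an initial segment of an A-definable set E,
and P is not definable, so that definable properties of the final parts of P
spill over to elements of E above P.  Write I(x) for the realizations of
p_l | Ax.  By homogeneity of the monster model, I(x) is the unique coinitial
orbit in P of the automorphisms fixing Ax.

The crucial case is that of triples: if x is in I(y) and z in I(x), then z
realizes p_l | Ayx.  Otherwise there is a definable family of initial segments
R(y, x) of P, each of them missing a point of I(x), which may be shrunk so as to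
be increasing in x.  Weak o-minimality and the overspill above P provide, for
x and z in I(x), a bound h such that z is in R(y, x) for all y > h.  Take x' > h
above x, and y above x' such that z is not in R(y, x'): then z is in
R(y, x), which is contained in R(y, x').

Longer sequences a_0 > ... > a_n are handled by adding one coordinate to A.
The loci of a_1, ..., a_n over A a_0 and of a_0, ..., a_(n-1) over A a_n lie in
the same E; the first has a definable upper cut only if the second has a
definable lower cut, so one of them is again of mixed kind. *)

Set Implicit Arguments.
Unset Strict Implicit.
Unset Printing Implicit Defensive.

Local Open Scope classical_set_scope.
Local Open Scope card_scope.

(** * Cardinals and contexts *)

Lemma dfunext (I : Type) (T : I -> Type) (f g : forall i, T i) :
  (forall i, f i = g i) -> f = g.
Proof. exact: functional_extensionality_dep. Qed.

Lemma dfunext2 (I : Type) (J : I -> Type) (T : forall i, J i -> Type)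
    (f g : forall i j, T i j) :
  (forall i j, f i j = g i j) -> f = g.
Proof. by move=> e; apply: dfunext => i; apply: dfunext => j. Qed.

Lemma finite_set_ind (T : Type) (P : set T -> Prop) (A : set T) :
  finite_set A -> P set0 -> (forall x B, P B -> P (x |` B)) -> P A.
Proof.
elim/Peq: T => T in P A *.
move=> /finite_seqP[s ->] P0 PS.
elim: s => [|x s IH]; first by rewrite set_nil.
suff -> : [set` x :: s] = x |` [set` s] by apply: PS.
apply/seteqP; split=> y /=; rewrite in_cons.
  by case/orP => [/eqP|]; [left|right].
by case=> [->|h]; rewrite ?eqxx ?h ?orbT.
Qed.

Section Cardinals.

Lemma inj_card_leT (T U : Type) (f : T -> U) :
  injective f -> [set: T] #<= [set: U].
Proof.
move=> fI; suff: $|{injfun [set: T] >-> [set: U]}|.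
  by case=> g; exact: inj_card_le g.
by apply/injfunPex; exists f => // x y _ _; apply: fI.
Qed.

Lemma card_leT_inj (T U : Type) :
  [set: T] #<= [set: U] -> exists f : T -> U, injective f.
Proof.
elim/Ppointed: U => U.
  rewrite emptyE => /eqP T0.
  have F (x : T) : False by have : [set: T] x by []; rewrite T0.
  by exists (fun x => False_rect _ (F x)) => x; case: (F x).
by move=> /pcard_injP[f fI]; exists f => x y; apply: fI; rewrite inE.
Qed.

(** Hilbert's hotel: along an embedded copy [n] of the natural numbers every point moves one step
    up, which frees [n 0] for [None]. *)
Lemma card_leT_option (T : Type) :
  infinite_set [set: T] -> [set: option T] #<= [set: T].
Proof.
move=> /infiniteP/card_leT_inj[n nI].
pose f (o : option T) : T :=
  if o is Some x then
    match pselect (exists i, n i = x) with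
    | left h => n (sval (cid h)).+1
    | right _ => x
    end
  else n 0.
apply: (@inj_card_leT _ _ f) => -[x|] [y|] //=.
- case: pselect => [h|h]; case: pselect => [h'|h'] //.
  + case: cid => i /= <-; case: cid => j /= <- /nI[->] //.
  + by move=> e; case: h'; exists (sval (cid h)).+1.
  + by move=> e; case: h; exists (sval (cid h')).+1.
  + by move=> ->.
- case: pselect => [h|h]; first by move/nI.
  by move=> e; case: h; exists 0.
- case: pselect => [h|h]; first by move/nI.
  by move=> e; case: h; exists 0.
Qed.

Lemma finite_option (T : Type) :
  finite_set [set: T] -> finite_set [set: option T].
Proof.
move=> fT; have -> : [set: option T] = None |` (Some @` [set: T]).
  by apply/seteqP; split=> // -[x _|_]; [right; exists x|left].
by rewrite finite_setU; split; [apply: finite_set1|apply: finite_image].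
Qed.

Lemma card_lt_inj (T U K : Type) (f : T -> U) :
  injective f -> card_lt U K -> card_lt T K.
Proof.
move=> /inj_card_leT TU [UK KU]; split; first exact: card_le_trans TU UK.
by move=> KT; apply: KU; apply: card_le_trans KT TU.
Qed.

Lemma card_lt_option (T K : Type) :
  infinite_set [set: K] -> card_lt T K -> card_lt (option T) K.
Proof.
move=> iK [TK KT]; have [fT|iT] := pselect (finite_set [set: T]).
  have fo := finite_option fT; split.
    have /infiniteP nK := iK.
    apply: card_le_trans nK.
    exact: finite_set_countable.
  by move=> Ko; apply: iK; apply: card_le_finite Ko fo.
have oT := card_leT_option iT; split; first exact: card_le_trans oT TK.
by move=> Ko; apply: KT; apply: card_le_trans Ko oT.
Qed.

End Cardinals.

Section Contexts.
Variable S : Type.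
Implicit Types (V W M : S -> Type).

(** Each variable of [D] costs one [option], so adjoining a finite tuple of parameters preserves
    smallness. *)
Lemma card_lt_context (T K : Type) (D : seq S) :
  infinite_set [set: K] -> card_lt T K ->
  card_lt (T + {s & var D s})%type K.
Proof.
move=> iK TK; elim: D => [|t D /(card_lt_option iK) IH].
  pose f (x : T + {s : S & void}) : T :=
    match x with inl y => y | inr z => match projT2 z with end end.
  by apply: (@card_lt_inj _ _ _ f) => // -[x|[]//] [y|[]//] /= ->.
pose f (x : T + {s & ext (var D) t s}) : option (T + {s & var D s}) :=
  match x with
  | inl y => Some (inl y)
  | inr (existT s (inl _)) => None
  | inr (existT s (inr v)) => Some (inr (existT _ s v))
  end.
apply: (@card_lt_inj _ _ _ f) => // -[x|[s [e|v]]] [y|[s' [e'|v']]] //=.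
- by case=> ->.
- by subst.
- by move=> e; have := congr1 (fun o => if o is Some (inr w) then
    inr (existT (ext (var D) t) (projT1 w) (inr (projT2 w)))
    else inr (existT (ext (var D) t) s (inr v))) e.
Qed.

Definition cincl (D1 D2 : seq S) : assign (var D1) (var (D1 ++ D2)).
Proof.
elim: D1 => [|t D IH] s /=; first by case.
by case=> [e|v]; [left|right; apply: IH].
Defined.

Definition cincr (D1 D2 : seq S) : assign (var D2) (var (D1 ++ D2)).
Proof. by elim: D1 => [|t D IH] s v //=; right; apply: IH. Defined.

Definition ccase (D1 D2 : seq S) V (h1 : assign (var D1) V)
  (h2 : assign (var D2) V) : assign (var (D1 ++ D2)) V.
Proof.
elim: D1 h1 => [|t D IH] h1 s /=; first exact: h2.
case=> [e|v]; first by apply: h1; left.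
by apply: (IH (fun s v => h1 s (inr v))).
Defined.

Lemma ccasel (D1 D2 : seq S) V (h1 : assign (var D1) V)
  (h2 : assign (var D2) V) s v : ccase h1 h2 (cincl D2 v) = h1 s v.
Proof.
elim: D1 h1 v => [|t D IH] h1 //= [e|v] //=.
by rewrite (IH (fun s v => h1 s (inr v))).
Qed.

Lemma ccaser (D1 D2 : seq S) V (h1 : assign (var D1) V)
  (h2 : assign (var D2) V) s v : ccase h1 h2 (cincr D1 v) = h2 s v.
Proof. by elim: D1 h1 => [|t D IH] h1 //=; rewrite IH. Qed.

End Contexts.

(** * Semantics of first-order formulas *)

Section Semantics.
Variables (L : language) (M : structure L).
Implicit Types V W : srt L -> Type.

Definition acomp V W (a : assign W M) (f : assign V W) : assign V M :=
  fun s v => a s (f s v).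

Lemma eval_trename V W (f : assign V W) (a : assign W M) s (t : term V s) :
  eval a (trename f t) = eval (acomp a f) t.
Proof.
elim: t => [t v|g u IH] //=.
by congr funI; apply: dfunext2 => t v; apply: IH.
Qed.

Lemma acons_ext V W (f : assign V W) (a : assign W M) s (x : M s) :
  acomp (acons x a) (@fmap_ext _ _ _ f s) = acons x (acomp a f).
Proof. by apply: dfunext2 => t [e|v]. Qed.

Lemma sat_rename V W (f : assign V W) (a : assign W M) (phi : formula V) :
  sat a (rename f phi) <-> sat (acomp a f) phi.
Proof.
elim: phi W f a => [{}V|{}V s t u|{}V r u|{}V p IHp q IHq|{}V s p IH] W f a /=.
- by [].
- by rewrite !eval_trename.
- set b := fun s v => _; set c := fun s v => _.
  by have -> : b = c by apply: dfunext2 => t v; apply: eval_trename.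
- by rewrite IHp IHq.
- by split=> h x; move: (h x); rewrite IH acons_ext.
Qed.

Lemma eval_aut (g : forall s, M s -> M s) : automorphism g ->
  forall V (a : assign V M) s (t : term V s),
  eval (fun s v => g s (a s v)) t = g s (eval a t).
Proof.
move=> ga V a s; elim=> [t v|f u IH] //=.
by rewrite (aut_fun ga); congr funI; apply: dfunext2 => t v; apply: IH.
Qed.

Lemma sat_aut (g : forall s, M s -> M s) : automorphism g ->
  forall V (phi : formula V) (a : assign V M),
  sat (fun s v => g s (a s v)) phi <-> sat a phi.
Proof.
move=> ga V; elim=> [{}V|{}V s t u|{}V r u|{}V p IHp q IHq|{}V s p IH] a /=.
- by [].
- rewrite !(eval_aut ga); have [h hK _] := aut_bij ga s.
  by split=> [/(can_inj hK)|->].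
- rewrite [X in _ <-> X](aut_rel ga); set b := fun s v => _; set c := fun s v => _.
  by have -> : b = c by apply: dfunext2 => t v; apply: eval_aut.
- by rewrite IHp IHq.
- have E (x : M s) : acons (g s x) (fun s v => g s (a s v)) =
    (fun t v => g t (acons x a v)).
    by apply: dfunext2 => t [e|v] //=; case: _ / e.
  have [h hK Kh] := aut_bij ga s.
  split=> H x; first by apply/IH; rewrite -E.
  by rewrite -[x]Kh E; apply/IH.
Qed.

Lemma automorphism_comp (g h : forall s, M s -> M s) :
  automorphism g -> automorphism h -> automorphism (fun s x => g s (h s x)).
Proof.
move=> ga ha; split.
- by move=> s; apply: bij_comp; [apply: (aut_bij ga)|apply: (aut_bij ha)].
- by move=> f a; rewrite (aut_fun ha) (aut_fun ga).
- by move=> r a; rewrite (aut_rel ha) (aut_rel ga).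
Qed.

Lemma automorphism_id : automorphism (fun (s : srt L) (x : M s) => x).
Proof. by split=> // s; exists id. Qed.

Lemma automorphism_inv (g : forall s, M s -> M s) : automorphism g ->
  exists h : forall s, M s -> M s,
    [/\ automorphism h, forall s, cancel (g s) (h s) & forall s, cancel (h s) (g s)].
Proof.
move=> ga.
have E s : exists h : M s -> M s, cancel (g s) h /\ cancel h (g s).
  by case: (aut_bij ga s) => h; exists h.
pose h s := sval (cid (E s)); exists h.
have gh s : cancel (g s) (h s) by rewrite /h; case: cid => ? [].
have hg s : cancel (h s) (g s) by rewrite /h; case: cid => ? [].
split=> //; split.
- by move=> s; exists (g s).
- move=> f a; apply: (can_inj (gh _)); rewrite hg (aut_fun ga); congr funI.
  by apply: dfunext2 => s v; rewrite hg.
- move=> r a; rewrite [X in _ <-> X](aut_rel ga).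
  have -> // : (fun s v => g s (h s (a s v))) = a.
  by apply: dfunext2 => s v; rewrite hg.
Qed.

(** [FAll] binds one variable, so the tuple is bound head first: [f] puts the head in the bound
    position and [f'] moves it on into the context. *)
Lemma sat_forall_tuple (D : seq (srt L)) V (phi : formula (fsum V (var D))) :
  exists psi : formula V, forall a,
    sat a psi <-> forall t : tup M D, sat (asum a t) phi.
Proof.
elim: D V phi => [|s D IH] V phi.
  pose f : assign (fsum V (fun=> void)) V :=
    fun t v => match v with inl x => x | inr z => match z with end end.
  exists (rename f phi) => a; rewrite sat_rename.
  have E t : acomp a f = asum a t by apply: dfunext2 => ? [?|[]].
  split=> [h t|h]; first by rewrite -E.
  by rewrite (E (fun s (v : void) => match v with end)).
pose f : assign (fsum V (ext (var D) s)) (ext (fsum V (var D)) s) :=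
  fun t v => match v with
    | inl x => inr (inl x) | inr (inl e) => inl e | inr (inr y) => inr (inr y)
    end.
pose f' : assign (ext (fsum V (var D)) s) (fsum (ext V s) (var D)) :=
  fun t v => match v with
    | inl e => inl (inl e) | inr (inl x) => inl (inr x) | inr (inr y) => inr y
    end.
have [psi psiP] := IH _ (rename f' (rename f phi)).
exists (FAll psi) => a /=.
have E x t : acomp (acomp (asum (acons x a) t) f') f = asum a (acons x t).
  by apply: dfunext2 => ? [?|[?|?]].
split=> [h t|h x].
  have /psiP/(_ (fun s v => t s (inr v))) := h (t s (inl erefl)).
  rewrite !sat_rename E; congr sat; apply: dfunext2 => t' [v|[e|v]] //=.
  by case: _ / e.
by apply/psiP => t; rewrite !sat_rename E.
Qed.

Definition factors V (D D' : seq (srt L)) (h : assign (var D) V)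
    (h' : assign (var D') V) :=
  exists k : assign (var D) (var D'), forall s v, h' s (k s v) = h s v.

Lemma factors_pair V (D1 D2 : seq (srt L)) (h1 : assign (var D1) V)
    (h2 : assign (var D2) V) :
  factors h1 (ccase h1 h2) /\ factors h2 (ccase h1 h2).
Proof.
split; [exists (@cincl _ D1 D2)|exists (@cincr _ D1 D2)] => s v.
  exact: ccasel.
exact: ccaser.
Qed.

(* [tsupp t h] and [fsupp phi h] say that, up to equivalence in M, only the
   variables in the range of h occur. *)
Definition tsupp V s (t : term V s) (D : seq (srt L)) (h : assign (var D) V) :=
  exists t' : term (var D) s, forall a : assign V M,
    eval a t = eval (acomp a h) t'.

Definition fsupp V (phi : formula V) (D : seq (srt L)) (h : assign (var D) V) :=
  exists phi' : formula (var D), forall a : assign V M,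
    sat a phi <-> sat (acomp a h) phi'.

Lemma acomp_factors V D D' (h : assign (var D) V) (h' : assign (var D') V) k :
  (forall s v, h' s (k s v) = h s v) ->
  forall a : assign V M, acomp (acomp a h') k = acomp a h.
Proof. by move=> hk a; apply: dfunext2 => s v; rewrite /acomp hk. Qed.

Lemma tsupp_weaken V s (t : term V s) D D' (h : assign (var D) V)
    (h' : assign (var D') V) : factors h h' -> tsupp t h -> tsupp t h'.
Proof.
move=> [k hk] [t' tP]; exists (trename k t') => a.
by rewrite eval_trename (acomp_factors hk).
Qed.

Lemma fsupp_weaken V (phi : formula V) D D' (h : assign (var D) V)
    (h' : assign (var D') V) : factors h h' -> fsupp phi h -> fsupp phi h'.
Proof.
move=> [k hk] [phi' phiP]; exists (rename k phi') => a.
by rewrite phiP sat_rename (acomp_factors hk).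
Qed.

Lemma finite_family_supp V (E : seq (srt L))
    (u : forall s, var E s -> term V s) :
  (forall s v, exists D (h : assign (var D) V), tsupp (u s v) h) ->
  exists D (h : assign (var D) V), forall s v, tsupp (u s v) h.
Proof.
elim: E u => [|t E IH] u H.
  by exists [::], (fun s (v : void) => match v with end) => s [].
have [D1 [h1 H1]] := H t (inl erefl).
have [D2 [h2 H2]] := IH (fun s v => u s (inr v)) (fun s v => H s (inr v)).
have [f1 f2] := factors_pair h1 h2.
exists _, (ccase h1 h2) => s [e|v]; last exact: tsupp_weaken (H2 s v).
by case: _ / e; apply: tsupp_weaken H1.
Qed.

Lemma tsupp_args V (E : seq (srt L)) (u : forall s, var E s -> term V s)
    D (h : assign (var D) V) : (forall s v, tsupp (u s v) h) ->
  exists u' : forall s, var E s -> term (var D) s,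
    forall a : assign V M, (fun s v => eval a (u s v)) =
      (fun s v => eval (acomp a h) (u' s v)).
Proof.
move=> H; exists (fun s v => sval (cid (H s v))) => a.
by apply: dfunext2 => s v; case: cid.
Qed.

Lemma term_supp V s (t : term V s) :
  exists D (h : assign (var D) V), tsupp t h.
Proof.
elim: t => [{}s v|f u IH].
  pose h : assign (var [:: s]) V := fun t v' => match v' with
    | inl e => eq_rect s V v t e | inr z => match z with end end.
  by exists [:: s], h, (TVar (inl erefl : var [:: s] s)).
have [D [h H]] := finite_family_supp IH.
have [u' uP] := tsupp_args H.
by exists D, h, (TFun u') => a /=; rewrite uP.
Qed.

(** Each variable of [D] either names the bound variable and is dropped, or comes from [V] and is
    kept in [D']. *)
Lemma binder_context V s D (h : assign (var D) (ext V s)) :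
  exists D' (h' : assign (var D') V) (k : assign (var D) (ext (var D') s)),
    forall t v, fmap_ext h' (k t v) = h t v.
Proof.
elim: D h => [|t D IH] h.
  by exists [::], (fun s (v : void) => match v with end),
    (fun s (v : void) => match v with end) => ? [].
have [D' [h' [k hk]]] := IH (fun t v => h t (inr v)).
case E: (h t (inl erefl)) => [e|w].
  pose k' : assign (var (t :: D)) (ext (var D') s) := fun t' v => match v with
    | inl e' => inl (etrans e e') | inr v' => k t' v' end.
  exists D', h', k' => t' [e'|v] /=; last exact: hk.
  by case: _ / e'; rewrite E.
pose h'' : assign (var (t :: D')) V := fun t' v => match v with
  | inl e' => eq_rect t V w t' e' | inr v' => h' t' v' end.
pose k' : assign (var (t :: D)) (ext (var (t :: D')) s) :=
  fun t' v => match v with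
  | inl e' => inr (inl e')
  | inr v' => match k t' v' with inl e => inl e | inr y => inr (inr y) end end.
exists (t :: D'), h'', k' => t' [e'|v] /=; first by case: _ / e'; rewrite E.
by rewrite -hk; case: (k t' v).
Qed.

(** The family [V] may be infinite, as when all elements of [M] serve as names, but a formula
    mentions finitely many variables. This trades parameters for a finite context. *)
Lemma formula_supp V (phi : formula V) :
  exists D (h : assign (var D) V), fsupp phi h.
Proof.
elim: phi => [{}V|{}V s t u|{}V r u|{}V p [D1 [h1 H1]] q [D2 [h2 H2]]|{}V s p].
- by exists [::], (fun s (v : void) => match v with end), FFalse.
- have [D1 [h1 H1]] := term_supp t; have [D2 [h2 H2]] := term_supp u.
  have [f1 f2] := factors_pair h1 h2; exists _, (ccase h1 h2).
  have [t' tP] := tsupp_weaken f1 H1; have [u' uP] := tsupp_weaken f2 H2.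
  by exists (FEq t' u') => a /=; rewrite tP uP.
- have [D [h H]] := finite_family_supp (fun s v => term_supp (u s v)).
  have [u' uP] := tsupp_args H.
  by exists D, h, (FRel u') => a /=; rewrite uP.
- have [f1 f2] := factors_pair h1 h2; exists _, (ccase h1 h2).
  have [p' pP] := fsupp_weaken f1 H1; have [q' qP] := fsupp_weaken f2 H2.
  by exists (FImp p' q') => a /=; rewrite pP qP.
- move=> [D [h [p' pP]]]; have [D' [h' [k hk]]] := binder_context h.
  exists D', h', (FAll (rename k p')) => a /=.
  have E x : acomp (acons x (acomp a h')) k = acomp (acons x a) h.
    apply: dfunext2 => t v; rewrite /acomp -hk.
    by case: (k t v).
  by split=> H x; move: (H x); rewrite sat_rename E pP.
Qed.

End Semantics.

(** * Definable relations *)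

Notation "B +: c" := (add_params B [set c]) (at level 50).

Section Definability.
Variables (L : language) (M : structure L) (G : seq (srt L)).
Local Notation X := (tup M G).
Implicit Types (B : params M) (R : (nat -> X) -> Prop) (S : set X).

Definition act (g : forall s, M s -> M s) (x : X) : X := fun s v => g s (x s v).

Definition evar : srt L -> Type := fun s => (nat * var G s)%type.

Definition env (e : nat -> X) : assign evar M := fun s v => e v.1 s v.2.

(* Relations on finitely many elements of X are encoded as predicates on
   environments, the variables being de Bruijn indices. *)
Definition defin B R := exists phi : lform B evar, forall e, R e <-> asat (env e) phi.

Definition defin1 B S := defin B (fun e => S (e 0)).
Definition defin2 B (r : X -> X -> Prop) := defin B (fun e => r (e 0) (e 1)).
Definition defin3 B (r : X -> X -> X -> Prop) :=
  defin B (fun e => r (e 0) (e 1) (e 2)).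

Definition sub_params B B' := forall s, B s `<=` B' s.

Definition in_params B (c : X) := forall s v, B s (c s v).

Definition is_tm B (t : (nat -> X) -> X) :=
  (exists i, forall e, t e = e i) \/
  (exists2 c, in_params B c & forall e, t e = c).

Lemma is_tm_var B i : is_tm B (fun e => e i).
Proof. by left; exists i. Qed.

Lemma is_tm_cst B c : in_params B c -> is_tm B (fun=> c).
Proof. by right; exists c. Qed.

Lemma defin_ext B R R' : (forall e, R e <-> R' e) -> defin B R -> defin B R'.
Proof. by move=> RR [phi H]; exists phi => e; rewrite -RR. Qed.

Lemma defin_sub B R (t : nat -> (nat -> X) -> X) :
  (forall i, is_tm B (t i)) -> defin B R -> defin B (fun e => R (fun i => t i e)).
Proof.
move=> ht [phi H].
have E i : exists o : nat + {c | in_params B c},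
    forall e, t i e = match o with inl j => e j | inr c => sval c end.
  case: (ht i) => [[j hj]|[c cB hc]]; first by exists (inl j).
  by exists (inr (exist _ c cB)).
pose o i := sval (cid (E i)).
have oP i e : t i e = match o i with inl j => e j | inr c => sval c end.
  by rewrite /o; case: cid.
pose f : assign (fsum evar (par B)) (fsum evar (par B)) := fun s v =>
  match v with
  | inl w => match o w.1 with
             | inl j => inl (j, w.2)
             | inr c => inr (exist _ (sval c s w.2) (svalP c s w.2))
             end
  | inr x => inr x
  end.
exists (rename f phi) => e; rewrite H /asat sat_rename.
suff -> : acomp (asum (env e) (fun s (x : par B s) => sval x)) f =
  asum (env (fun i => t i e)) (fun s (x : par B s) => sval x) by [].
apply: dfunext2 => s [w|x] //=; rewrite /acomp /f /env /= oP.
by case: (o w.1).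
Qed.

Lemma defin_mono B B' R : sub_params B B' -> defin B R -> defin B' R.
Proof.
move=> BB [phi H].
pose f : assign (fsum evar (par B)) (fsum evar (par B')) := fun s v =>
  match v with inl w => inl w | inr x => inr (exist _ (sval x) (BB s _ (svalP x))) end.
exists (rename f phi) => e; rewrite H /asat sat_rename.
suff -> : acomp (asum (env e) (fun s (x : par B' s) => sval x)) f =
  asum (env e) (fun s (x : par B s) => sval x) by [].
by apply: dfunext2 => s [w|x].
Qed.

Lemma defin_imp B R R' : defin B R -> defin B R' -> defin B (fun e => R e -> R' e).
Proof.
by move=> [p hp] [q hq]; exists (FImp p q) => e; rewrite hp hq.
Qed.

Lemma defin_false B : defin B (fun=> False).
Proof. by exists FFalse. Qed.

Lemma defin_not B R : defin B R -> defin B (fun e => ~ R e).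
Proof. by move=> h; apply: defin_imp h (defin_false B). Qed.

Lemma defin_true B : defin B (fun=> True).
Proof. by apply: defin_ext (defin_not (defin_false B)) => e; split=> // _ []. Qed.

Lemma defin_and B R R' : defin B R -> defin B R' -> defin B (fun e => R e /\ R' e).
Proof.
move=> h h'; apply: defin_ext (defin_not (defin_imp h (defin_not h'))) => e.
by split=> [/not_implyP[? /contrapT]|[? ?]] //; apply.
Qed.

Lemma defin_all B (R : X -> (nat -> X) -> Prop) :
  defin B (fun e => R (e 0) (fun n => e n.+1)) ->
  defin B (fun e => forall x, R x e).
Proof.
move=> [phi H].
pose f : assign (fsum evar (par B)) (fsum (fsum evar (par B)) (var G)) :=
  fun s v => match v with
  | inl (0, w) => inr w
  | inl (n.+1, w) => inl (inl (n, w))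
  | inr x => inl (inr x)
  end.
have [psi psiP] := sat_forall_tuple M (rename f phi).
exists psi => e; rewrite /asat psiP.
have E x : R x e <-> sat (asum (asum (env e) (fun s (x : par B s) => sval x)) x)
    (rename f phi).
  rewrite sat_rename.
  have /= -> := H (fun n => if n is m.+1 then e m else x).
  rewrite /asat; set a := asum _ _; set b := acomp _ _.
  by have -> : a = b by apply: dfunext2 => s [[[|n] w]|y].
by split=> h x; apply/E.
Qed.

Lemma defin_ex B (R : X -> (nat -> X) -> Prop) :
  defin B (fun e => R (e 0) (fun n => e n.+1)) ->
  defin B (fun e => exists x, R x e).
Proof.
move=> h; apply: defin_ext (defin_not (defin_all (defin_not h))) => e /=.
by symmetry; apply: not_existsP.
Qed.

Lemma defin1E B S t : defin1 B S -> is_tm B t -> defin B (fun e => S (t e)).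
Proof. by move=> h ht; apply: (@defin_sub _ _ (fun=> t)) h. Qed.

Lemma defin2E B r t1 t2 : defin2 B r -> is_tm B t1 -> is_tm B t2 ->
  defin B (fun e => r (t1 e) (t2 e)).
Proof.
move=> h h1 h2.
by apply: (@defin_sub _ _ (fun i => if i is 0 then t1 else t2)) h => -[|i].
Qed.

Lemma defin3E B r t1 t2 t3 : defin3 B r -> is_tm B t1 -> is_tm B t2 ->
  is_tm B t3 -> defin B (fun e => r (t1 e) (t2 e) (t3 e)).
Proof.
move=> h h1 h2 h3.
by apply: (@defin_sub _ _ (fun i => match i with 0 => t1 | 1 => t2 | _ => t3 end))
  h => -[|[|i]].
Qed.

Lemma defin1_formula B S :
  defin1 B S <-> exists phi : lform B (var G), S = solutions phi.
Proof.
split=> -[phi H].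
  pose f : assign (fsum evar (par B)) (fsum (var G) (par B)) := fun s v =>
    match v with inl w => inl w.2 | inr x => inr x end.
  exists (rename f phi); apply/seteqP; rewrite /solutions /asat /=.
  by split=> x; rewrite /= sat_rename (H (fun=> x)) /asat; congr sat;
    apply: dfunext2 => s [].
pose f : assign (fsum (var G) (par B)) (fsum evar (par B)) := fun s v =>
  match v with inl w => inl (0, w) | inr x => inr x end.
exists (rename f phi) => e; rewrite H /solutions /asat /= sat_rename.
set a := asum _ _; set b := acomp _ _.
by have -> : a = b by apply: dfunext2 => s [].
Qed.

Lemma defin2_rel_of B (la : lform B (fsum (var G) (var G))) :
  defin2 B (rel_of la).
Proof.
pose f : assign (fsum (fsum (var G) (var G)) (par B)) (fsum evar (par B)) :=
  fun s v => match v with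
  | inl (inl w) => inl (0, w) | inl (inr w) => inl (1, w) | inr x => inr x end.
exists (rename f la) => e; rewrite /rel_of /asat sat_rename.
set a := asum _ _; set b := acomp _ _.
by have -> : a = b by apply: dfunext2 => s [[]|].
Qed.

Definition autfix B g := automorphism g /\ forall s x, B s x -> g s x = x.

Lemma defin_aut B g R e : autfix B g -> defin B R ->
  R (fun i => act g (e i)) <-> R e.
Proof.
move=> [ga gB] [phi H]; rewrite !H /asat -[X in _ <-> X](sat_aut ga).
pose b (e : nat -> X) := asum (env e) (fun s (x : par B s) => sval x).
have -> // : (fun s v => g s (b e s v)) = b (fun i => act g (e i)).
by apply: dfunext2 => s [w|x] //=; rewrite gB //; apply: svalP.
Qed.

Lemma defin1_aut B g S x : autfix B g -> defin1 B S -> S (act g x) <-> S x.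
Proof. by move=> gB h; exact: (defin_aut (fun=> x) gB h). Qed.

Lemma defin2_aut B g r x y : autfix B g -> defin2 B r ->
  r (act g x) (act g y) <-> r x y.
Proof.
by move=> gB h; exact: (defin_aut (fun i => if i is 0 then x else y) gB h).
Qed.

Lemma defin3_aut B g r x y z : autfix B g -> defin3 B r ->
  r (act g x) (act g y) (act g z) <-> r x y z.
Proof.
move=> gB h.
exact: (defin_aut (fun i => match i with 0 => x | 1 => y | _ => z end) gB h).
Qed.

Lemma autfix_comp B g h : autfix B g -> autfix B h ->
  autfix B (fun s x => g s (h s x)).
Proof.
move=> [ga gB] [ha hB]; split; first exact: automorphism_comp.
by move=> s x Bx; rewrite hB ?gB.
Qed.

Lemma autfix_id B : autfix B (fun s x => x).
Proof. by split=> //; apply: automorphism_id. Qed.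

Lemma autfix_inv B g : autfix B g ->
  exists h, [/\ autfix B h, cancel (act g) (act h) & cancel (act h) (act g)].
Proof.
move=> [ga gB]; have [h [ha gh hg]] := automorphism_inv ga; exists h.
split; first by split=> // s x Bx; rewrite -[LHS](congr1 (h s) (gB s x Bx)) gh.
- by move=> x; apply: dfunext2 => s v; rewrite /act gh.
- by move=> x; apply: dfunext2 => s v; rewrite /act hg.
Qed.

Lemma autfix_mono B B' g : sub_params B B' -> autfix B' g -> autfix B g.
Proof. by move=> BB [ga gB]; split=> // s x /BB/gB. Qed.

Lemma sub_add B (E : set X) : sub_params B (add_params B E).
Proof. by move=> s x Bx; left. Qed.

Lemma in_add B c : in_params (B +: c) c.
Proof. by move=> s v; right; exists c => //; exists v. Qed.

Lemma in_sub B B' c : sub_params B B' -> in_params B c -> in_params B' c.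
Proof. by move=> BB Bc s v; apply: BB. Qed.

Lemma autfix_in B g c : autfix B g -> in_params B c -> act g c = c.
Proof. by move=> [_ gB] Bc; apply: dfunext2 => s v; rewrite /act gB. Qed.

Lemma autfix_add B g c : autfix B g -> act g c = c -> autfix (B +: c) g.
Proof.
move=> [ga gB] gc; split=> // s x [/gB//|[_ /= -> [v <-]]].
by rewrite -[in RHS]gc.
Qed.

(** The names that come from [c] become coordinates of a new variable of index 0, and the other
    variables shift up by one. *)
Lemma defin_extract B c R : defin (B +: c) R ->
  exists2 R', defin B R' & forall e, R e <-> R' (fun n => if n is m.+1 then e m else c).
Proof.
move=> [phi H].
have E s (x : par (B +: c) s) : exists o : par B s + var G s,
    sval x = match o with inl y => sval y | inr v => c s v end.
  case: x => x [Bx|[_ /= -> [v <-]]]; first by exists (inl (exist _ x Bx)).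
  by exists (inr v).
pose f : assign (fsum evar (par (B +: c))) (fsum evar (par B)) := fun s v =>
  match v with
  | inl w => inl (w.1.+1, w.2)
  | inr x => match sval (cid (E s x)) with inl y => inr y | inr v => inl (0, v) end
  end.
exists (fun e => asat (env e) (rename f phi)); first by exists (rename f phi).
move=> e; rewrite H /asat sat_rename.
set a := asum _ _; set b := acomp _ _.
have -> // : a = b; apply: dfunext2 => s [w|x] //=; rewrite /b /acomp /=.
by case: cid => -[y|v] /= ->.
Qed.

Lemma defin1_extract B c S : defin1 (B +: c) S ->
  exists2 r, defin2 B r & forall x, S x <-> r c x.
Proof.
move=> /defin_extract[R RB RP].
exists (fun y x => R (fun n => if n is 0 then y else x)).
  by apply: (@defin_sub _ _ (fun n e => if n is 0 then e 0 else e 1)) RB => -[|n];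
    apply: is_tm_var.
by move=> x; rewrite (RP (fun=> x)).
Qed.

Lemma defin1_extract2 B c d S : defin1 (B +: c +: d) S ->
  exists2 r, defin3 B r & forall x, S x <-> r c d x.
Proof.
move=> /defin1_extract[r rB rP].
have [R RB RP] := defin_extract rB.
exists (fun y x z => R (fun n => match n with 0 => y | 1 => x | _ => z end)).
  by apply: (@defin_sub _ _ (fun n e => match n with 0 => e 0 | 1 => e 1 | _ => e 2 end))
    RB => -[|[|n]]; apply: is_tm_var.
by move=> x; rewrite rP (RP (fun n => if n is 0 then d else x)).
Qed.

(** The new elements are indexed by a finite context. The indexing is a functional relation and may
    be partial: in [defin_fin], a variable of the context need not name a parameter. *)
Definition fin_over B B' :=
  exists (D : seq (srt L)) (r : forall s, var D s -> M s -> Prop),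
  (forall s v x y, r s v x -> r s v y -> x = y) /\
  forall s x, B' s x -> B s x \/ exists v, r s v x.

Lemma fin_over_add B (c : X) : fin_over B (B +: c).
Proof.
exists G, (fun s v x => c s v = x); split=> [s v x y -> //|s x].
by case=> [|[_ /= -> ]]; [left|right].
Qed.

(** Saturation speaks of small parameter sets only. A formula over all of [M] is brought within its
    reach by keeping just the finitely many parameters that occur. *)
Lemma defin_fin B R : defin (allparams M) R ->
  exists B', [/\ sub_params B B', fin_over B B' & defin B' R].
Proof.
move=> [phi H]; have [D [h [phi' hP]]] := formula_supp M phi.
pose r s (v : var D s) (x : M s) := exists p, h s v = inr p /\ sval p = x.
exists (fun s => B s `|` [set x | exists v, r s v x]); split.
- by move=> s x; left.
- exists D, r; split=> // s v x y [p [e <-]] [q [+ <-]].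
  by rewrite e => -[->].
have E s (v : var D s) :
    exists o : (evar s + par (fun s => B s `|` [set x | exists v, r s v x]) s),
    match o with inl w => h s v = inl w
            | inr p => exists q, h s v = inr q /\ sval q = sval p end.
  case E: (h s v) => [w|p]; first by exists (inl w).
  have Hp : (B s `|` [set x | exists v, r s v x]) (sval p).
    by right; exists v, p.
  by exists (inr (exist _ (sval p) Hp)), p.
pose f s v := sval (cid (E s v)).
exists (rename f phi') => e; rewrite H /asat hP sat_rename.
set a := acomp _ _; set b := acomp _ _.
have -> // : a = b; apply: dfunext2 => s v; rewrite /a /b /acomp /f.
by case: cid => o /=; case: o => [w ->|p [q [-> /= ->]]].
Qed.

End Definability.

(** * Saturation and homogeneity in terms of definable sets *)

Section Monster.
Variables (L : language) (M : structure L) (K : Type) (hM : monster M K).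
Variable G : seq (srt L).
Local Notation X := (tup M G).
Implicit Types (B : params M) (S : set X).

(** There are fewer formulas than elements of [K], and the iterated negations of [FFalse] are
    already infinitely many. *)
Lemma monster_infinite : infinite_set [set: K].
Proof.
have [lK _] := monster_lang hM; apply/infiniteP.
apply: card_le_trans lK.
pose f := fix f (V : srt L -> Type) n : formula V :=
  if n is m.+1 then FNot (f V m) else FFalse.
have fI V : injective (f V).
  by elim=> [|m IH] [|n] //= [/IH ->].
apply: (@inj_card_leT _ _ (fun n => existT (fun G => formula (var G)) [::] (f _ n))).
move=> m n /= e; apply: (fI (fun=> void)).
pose k (w : {G : seq (srt L) & formula (var G)}) : formula (fun=> void) :=
  match w with existT [::] phi => phi | _ => FFalse end.
exact: (congr1 k e).
Qed.

Lemma small_fin_over B B' : fin_over B B' -> small K (par B) -> small K (par B').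
Proof.
move=> [D [r [rf H]]] /(card_lt_context D monster_infinite) sB.
have E (u : {s & par B' s}) : exists o : {s & par B s} + {s & var D s},
  match o with
  | inl w => existT _ (projT1 u) (sval (projT2 u)) = existT M (projT1 w) (sval (projT2 w))
  | inr w => exists x, r (projT1 w) (projT2 w) x /\
     existT _ (projT1 u) (sval (projT2 u)) = existT M (projT1 w) x
  end.
  case: u => s [x Bx] /=; case: (H s x Bx) => [Bx'|[v vx]].
    by exists (inl (existT _ s (exist _ x Bx'))).
  by exists (inr (existT _ s v)), x.
have K1 (t1 t2 : {s & M s}) (h1 : B' (projT1 t1) (projT2 t1))
   (h2 : B' (projT1 t2) (projT2 t2)) : t1 = t2 ->
   existT (par B') (projT1 t1) (exist _ (projT2 t1) h1) =
   existT (par B') (projT1 t2) (exist _ (projT2 t2) h2).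
  by move=> e; subst t2; rewrite (Prop_irrelevance h1 h2).
apply: (@card_lt_inj _ _ _ (fun u => sval (cid (E u))) _ sB).
move=> u1 u2 /=; case: cid => o1 P1; case: cid => o2 P2 /= e; subst o2.
have e : existT M (projT1 u1) (sval (projT2 u1)) =
         existT M (projT1 u2) (sval (projT2 u2)).
  case: o1 P1 P2 => [w -> ->//|w [x [rx ->]] [y [ry ->]]].
  by rewrite (rf _ _ _ _ rx ry).
case: u1 u2 {P1 P2} e => [s [x h]] [s' [x' h']] /= e.
exact: (K1 (existT M s x) (existT M s' x') h h' e).
Qed.

Lemma small_add B (c : X) : small K (par B) -> small K (par (B +: c)).
Proof. by apply: small_fin_over; apply: fin_over_add. Qed.

Lemma small_sub B B' : sub_params B' B -> small K (par B) -> small K (par B').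
Proof.
move=> BB; apply: small_fin_over.
by exists [::], (fun _ _ _ => False); split=> // s x /BB; left.
Qed.

(** Saturation for a family closed under intersection: finite satisfiability reduces to the
    nonemptiness of each member. *)
Lemma compactness B (F : set X -> Prop) : small K (par B) ->
  (forall S, F S -> defin1 B S) -> F setT ->
  (forall S S', F S -> F S' -> F (S `&` S')) -> (forall S, F S -> S !=set0) ->
  exists x, forall S, F S -> S x.
Proof.
move=> sB FB F1 FI F0.
pose p : set (lform B (var G)) := [set phi | F (solutions phi)].
have : finsat p.
  move=> E fE Ep.
  suff [x xP] : [set x | forall phi, E phi -> solutions phi x] !=set0.
    by exists x => phi /xP.
  apply: F0; move: Ep.
  apply: (finite_set_ind (P := fun E => E `<=` p ->
    F [set x | forall phi, E phi -> solutions phi x]) fE) => [_|phi E' IH Ep].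
    by rewrite [X in F X](_ : _ = setT) //; apply/seteqP; split=> // x _ phi [].
  rewrite [X in F X](_ : _ = solutions phi `&`
    [set x | forall phi, E' phi -> solutions phi x]).
    apply: FI; first by apply: Ep; left.
    by apply: IH => psi h; apply: Ep; right.
  apply/seteqP; split=> x /=.
    by move=> H; split=> [|psi h]; apply: H; [left|right].
  by move=> [h H] psi [->//|/H].
move=> /(monster_sat hM sB)[x xP]; exists x => S FS.
have [phi e] := (defin1_formula _ _).1 (FB S FS).
by rewrite e; apply: xP; rewrite /p /= -e.
Qed.

(** Homogeneity is applied to [x] together with all of [B], so that the automorphism fixes [B]. One
    inclusion of types suffices, because complements of definable sets are definable. *)
Lemma homogeneity B x y : small K (par B) ->
  (forall S, defin1 B S -> S x -> S y) -> exists2 g, autfix B g & act g x = y.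
Proof.
move=> sB H; pose V := fsum (var G) (par B).
have sV : small K V.
  have := card_lt_context G monster_infinite sB.
  pose f (u : {s & V s}) : {s & par B s} + {s & var G s} := match u with
    | existT s (inl v) => inr (existT _ s v)
    | existT s (inr x) => inl (existT _ s x) end.
  apply: (@card_lt_inj _ _ _ f).
  pose h (w : {s & par B s} + {s & var G s}) : {s & V s} := match w with
    | inl u => existT V (projT1 u) (inr (projT2 u))
    | inr u => existT V (projT1 u) (inl (projT2 u)) end.
  by apply: (can_inj (g := h)) => -[s []].
pose a (x : X) := asum x (fun s (z : par B s) => sval z).
have [|g ga gP] := monster_hom hM sV (a := a x) (b := a y).
  move=> phi; pose S := @solutions _ _ B G phi.
  have SB : defin1 B S by apply/defin1_formula; exists phi.
  split; first exact: (H S SB).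
  move=> hy; apply: contrapT => hx.
  exact: (H (~` S) (defin_not SB) hx hy).
exists g; last by apply: dfunext2 => s v; exact: (gP s (inl v)).
by split=> // s z Bz; exact: (gP s (inr (exist _ z Bz))).
Qed.

End Monster.

Lemma in_any (L : language) (M : structure L) (G : seq (srt L)) (c : tup M G) :
  in_params (allparams M) c.
Proof. by []. Qed.

(** Definability by recursion on the shape of a relation. The atoms are looked up in the context,
    hence the [have] steps that first bring them to the parameter set of the goal. *)
Ltac dfn := rewrite /defin1 /defin2 /defin3; repeat first
  [ apply: is_tm_var
  | (apply: is_tm_cst; solve [exact: in_any | exact: in_add | eassumption])
  | (eapply defin3E; [eassumption | | |])
  | (eapply defin2E; [eassumption | |])
  | (eapply defin1E; [eassumption |])
  | apply: defin_and | apply: defin_imp | apply: defin_not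
  | apply: defin_ex | apply: defin_all | apply: defin_false ].

(** * Linear orders and convex sets *)

Section Orders.
Variable T : Type.
Implicit Types (lt : T -> T -> Prop) (D E P S : set T).

Definition leo lt x y := x = y \/ lt x y.

Definition flip lt : T -> T -> Prop := fun x y => lt y x.

(** For the set of realizations of p, this is membership of the formula defining [S] in p_l; with
    [flip lt], in p_r. *)
Definition large lt P S := exists2 c, P c & forall x, P x -> leo lt x c -> S x.

Definition finconv E lt S := exists n (C : 'I_n -> set T),
  (forall i, convex_in E lt (C i)) /\ S = \bigcup_i C i.

Lemma linear_order_on_rev D lt : linear_order_on D lt -> linear_order_on D (flip lt).
Proof.
move=> [irr tr tot]; split=> // [x y z Dx Dy Dz xy yz|x y Dx Dy].
  exact: (tr z y x).
by case: (tot x y Dx Dy); [constructor 3|constructor 2|constructor 1].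
Qed.

Lemma finconv_rev E lt S : finconv E lt S -> finconv E (flip lt) S.
Proof.
move=> [n [C [CC ->]]]; exists n, C; split=> // i; have [CE cC] := CC i.
by split=> // x y z Cx Cz Ey yx zy; apply: (cC z y x).
Qed.

Lemma linear_order_on_sub D E lt : E `<=` D ->
  linear_order_on D lt -> linear_order_on E lt.
Proof.
move=> ED [irr tr tot]; split=> [x /ED/irr //|x y z /ED Dx /ED Dy /ED Dz|].
  exact: tr.
by move=> x y /ED Dx /ED; apply: tot.
Qed.

Section Linear.
Variables (D : set T) (lt : T -> T -> Prop).
Hypothesis lin : linear_order_on D lt.
Local Notation le := (leo lt).

Lemma lt_irr x : D x -> ~ lt x x.
Proof. by case: lin => h _ _; apply: h. Qed.

Lemma lt_tr x y z : D x -> D y -> D z -> lt x y -> lt y z -> lt x z.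
Proof. by case: lin => _ h _; apply: h. Qed.

Lemma le_lt_tr x y z : D x -> D y -> D z -> le x y -> lt y z -> lt x z.
Proof. by move=> Dx Dy Dz [->//|]; apply: lt_tr. Qed.

Lemma lt_le_tr x y z : D x -> D y -> D z -> lt x y -> le y z -> lt x z.
Proof. by move=> Dx Dy Dz xy [<-//|]; apply: lt_tr. Qed.

Lemma le_tr x y z : D x -> D y -> D z -> le x y -> le y z -> le x z.
Proof. by move=> Dx Dy Dz [->//|xy] yz; right; apply: lt_le_tr yz. Qed.

Lemma nlt_le x y : D x -> D y -> ~ lt x y -> le y x.
Proof.
by case: lin => _ _ h Dx Dy n; case: (h x y Dx Dy) => [/n|->|] //; [left|right].
Qed.

Lemma lt_nle x y : D x -> D y -> lt x y -> ~ le y x.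
Proof. by move=> Dx Dy xy yx; apply: (lt_irr Dx); apply: lt_le_tr yx. Qed.

Lemma nle_lt x y : D x -> D y -> ~ le x y -> lt y x.
Proof.
move=> Dx Dy n; apply: contrapT => h; apply: n; exact: nlt_le.
Qed.

Lemma le_total x y : D x -> D y -> le x y \/ le y x.
Proof.
move=> Dx Dy; case: (EM (lt x y)) => [|/(nlt_le Dx Dy)]; last by right.
by left; right.
Qed.

Lemma large_and P S S' : P `<=` D -> large lt P S -> large lt P S' ->
  large lt P (S `&` S').
Proof.
move=> PD [c Pc cS] [d Pd dS]; have Dc := PD _ Pc; have Dd := PD _ Pd.
case: (le_total Dc Dd) => cd.
  exists c => // x Px xc; split; first exact: cS.
  by apply: dS => //; apply: le_tr xc cd => //; apply: PD.
exists d => // x Px xd; split; last exact: dS.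
by apply: cS => //; apply: le_tr xd cd => //; apply: PD.
Qed.

(** If both fail, one convex piece of [S] has points of [P] arbitrarily low; a point of [P] outside
    [S] then falls between two points of that piece. *)
Lemma large_dich P E S : P `<=` E -> E `<=` D -> P !=set0 ->
  finconv E lt (S `&` E) -> large lt P S \/ large lt P (~` S).
Proof.
move=> PE ED [x0 Px0] [n [C [CC eC]]].
have PD : P `<=` D by move=> x /PE/ED.
case: (EM (large lt P S)) => [|nS]; first by left.
case: (EM (large lt P (~` S))) => [|nC]; first by right.
have low S' : ~ large lt P S' -> forall c, P c -> exists x, [/\ P x, le x c & ~ S' x].
  move=> nS' c Pc; apply: contrapT => h; apply: nS'; exists c => // x Px xc.
  by apply: contrapT => nx; apply: h; exists x.
(* Otherwise every piece avoids some initial part of [P]. The least of these finitely many parts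
   avoids all of [S], so the complement would be large. *)
have [i iC] : exists i, forall c, P c -> exists x, [/\ P x, le x c & C i x].
  apply: contrapT => nC'.
  have E' i : exists c, P c /\ forall x, P x -> le x c -> ~ C i x.
    apply: contrapT => h; apply: nC'; exists i => c Pc.
    apply: contrapT => h'; apply: h; exists c; split=> // x Px xc Cx.
    by apply: h'; exists x.
  have [f fP] := choice E'.
  have [c Pc cf] : exists2 c, P c & forall i, le c (f i).
    have : exists2 c, P c & forall i, i \in enum 'I_n -> le c (f i).
      elim: (enum 'I_n) => [|j s [c Pc cs]]; first by exists x0.
      have Pj := (fP j).1.
      case: (le_total (PD _ Pc) (PD _ Pj)) => h.
        by exists c => // i; rewrite in_cons => /orP[/eqP ->|/cs].
      exists (f j) => // i; rewrite in_cons => /orP[/eqP ->|/cs ci]; first by left.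
      by apply: le_tr h ci; apply: PD => //; apply: (fP i).1.
    by move=> [c Pc h]; exists c => // i; apply: h; rewrite mem_enum.
  have [x [Px xc /contrapT Sx]] := low _ nC c Pc.
  have : (S `&` E) x by split=> //; apply: PE.
  rewrite eC => -[j _ Cx]; apply: (fP j).2 Cx => //.
  by apply: le_tr xc (cf j); apply: PD => //; apply: (fP j).1.
have [c [Pc _ Cc]] := iC _ Px0.
have [x [Px xc nx]] := low _ nS c Pc.
have [y [Py yx Cy]] := iC _ Px.
have sub z : C i z -> S z.
  by move=> Cz; have [] : (S `&` E) z by rewrite eC; exists i.
case: nx; apply: sub; case: yx => [<-//|yx]; case: xc => [->//|xc].
by have [_ h] := CC i; apply: (h y x c) => //; apply: PE.
Qed.

(** Here [n] is the number of convex pieces: two of the [n.+1] points [u i] share a piece, and so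
    does the point [h j] between them. *)
Lemma no_alternation E S : E `<=` D -> finconv E lt (S `&` E) ->
  exists n, forall h u : nat -> T,
    (forall i, (i <= n)%N -> [/\ E (h i), E (u i), lt (h i) (u i) & lt (u i) (h i.+1)]) ->
    (forall i, (i <= n)%N -> S (u i)) -> (forall i, (i <= n)%N -> ~ S (h i)) -> False.
Proof.
move=> ED [n [C [CC eC]]]; exists n => h u hu Su Sh.
have F (i : 'I_n.+1) : exists j, C j (u i).
  have lei : (i <= n)%N by rewrite -ltnS.
  have [_ Eu _ _] := hu i lei.
  have : (S `&` E) (u i) by split=> //; apply: Su.
  by rewrite eC => -[j _]; exists j.
have [f fP] := choice F.
have ex : exists i j : 'I_n.+1, (i < j)%N /\ f i = f j.
  apply: contrapT => ne.
  have fI : injective f.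
    move=> i j e; apply: val_inj; case: (ltngtP i j) => // lij.
      by case: ne; exists i, j.
    by case: ne; exists j, i.
  by have := leq_card f fI; rewrite !card_ord ltnn.
have [i [j [ij e]]] := ex.
have len (k : 'I_n.+1) : (k <= n)%N by rewrite -ltnS.
have mono k : (i < k <= n)%N -> lt (u i) (h k).
  elim: k => [//|k IH] /andP[]; rewrite ltnS leq_eqVlt => /orP[/eqP <-|ik] kn.
    by case: (hu i (len i)).
  have [Ek Eu hk uk] := hu k (ltnW kn); have [Ek' _ _ _] := hu _ kn.
  have [_ Eui _ _] := hu i (len i).
  apply: (lt_tr _ _ _ _ uk); try exact: ED.
  by apply: (lt_tr _ _ _ _ hk); try exact: ED; apply: IH; rewrite ik ltnW.
have [Ej Euj hj _] := hu j (len j).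
have lij := mono j; rewrite ij len in lij.
apply: (Sh j (len j)).
have [_ cv] := CC (f i).
have Cj : C (f i) (h j).
  by apply: (cv (u i) (h j) (u j)) => //; [rewrite e|apply: lij].
by have [] : (S `&` E) (h j) by rewrite eC; exists (f i).
Qed.

End Linear.
End Orders.

(** * Loci of types of mixed kind *)

Section Locus.
Variables (L : language) (M : structure L) (K : Type) (hM : monster M K).
Variables (A : params M) (G : seq (srt L)).
Local Notation X := (tup M G).
Variables (lt : X -> X -> Prop) (D pC : set X).
Hypotheses (ltA : defin2 A lt) (lin : linear_order_on D lt) (pD : pC `<=` D).
Hypothesis wom : forall S, defin1 (allparams M) S -> finconv pC lt (S `&` pC).
Implicit Types (B : params M) (S E P : set X).
Local Notation le := (leo lt).

Lemma defin_any B R : defin B R -> defin (G := G) (allparams M) R.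
Proof. by apply: defin_mono => s x. Qed.

(* The locus P of a complete type over B such that the lower cut of P is
   definable over B while its upper cut is not definable. *)
Record locus B E P : Prop := Locus {
  loc_small : small K (par B);
  loc_A : sub_params A B;
  loc_E : defin1 B E;
  loc_ED : E `<=` D;
  loc_PE : P `<=` E;
  loc_init : forall x y, P x -> E y -> lt y x -> P y;
  loc_pC : P `<=` pC;
  loc_ne : P !=set0;
  loc_td : forall x, (forall S, defin1 B S -> P `<=` S -> S x) -> P x;
  loc_tr : forall x y, P x -> P y -> exists2 g, autfix B g & act g x = y;
  loc_nd : ~ defin1 (allparams M) P }.

(** Coinitiality of the orbit is easier to transport by automorphisms than the realization of a
    type. The order is an argument because [O_conj] uses cofinal orbits. *)
Definition orb (o : X -> X -> Prop) B P y :=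
  P y /\ forall c, P c -> exists2 g, autfix B g & leo o (act g y) c.

(* In the notation of the paper, I B P is the set of realizations of p_l | B. *)
Local Notation I := (orb lt).

(** A coinitial orbit meets every large set, hence lies in it when the set is definable over [B]. By
    the dichotomy, the large sets determine the type of [y] over [B]. *)
Lemma orb_conj o B P y y' : small K (par B) ->
  (forall S, defin1 B S -> large o P S \/ large o P (~` S)) ->
  (forall g x, autfix B g -> P x -> P (act g x)) ->
  orb o B P y -> orb o B P y' -> exists2 g, autfix B g & act g y = y'.
Proof.
move=> sB dich PB oy oy'; apply: (homogeneity hM sB) => S SB Sy.
have lS S' z : defin1 B S' -> orb o B P z -> large o P S' -> S' z.
  move=> SB' [Pz h] [c /h[g gB gz] cS].
  by apply/(defin1_aut _ gB SB'); apply: cS gz; apply: PB.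
case: (dich S SB) => [h|]; first exact: lS h.
by move=> /(lS _ _ (defin_not SB) oy).
Qed.

(** * Generic points at the lower end of a locus *)

Section InLocus.
Variables (B : params M) (E P : set X) (hP : locus B E P).

Let PD x : P x -> D x.
Proof. by move=> /(loc_PE hP)/(loc_ED hP). Qed.
#[local] Hint Resolve PD : core.

Lemma aut_P g x : autfix B g -> P x -> P (act g x).
Proof.
move=> gB Px; apply: (loc_td hP) => S SB PS.
by apply/(defin1_aut _ gB SB); apply: PS.
Qed.

Lemma ltB B' : sub_params B B' -> defin2 B' lt.
Proof.
by move=> BB; apply: defin_mono ltA => s x /(loc_A hP); apply: BB.
Qed.

Lemma aut_lt g x y : autfix B g -> lt x y -> lt (act g x) (act g y).
Proof. by move=> gB xy; apply/(defin2_aut _ _ gB (ltB (fun s x => id))). Qed.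

Lemma aut_le g x y : autfix B g -> le x y -> le (act g x) (act g y).
Proof. by move=> gB [->|/(aut_lt gB)]; [left|right]. Qed.

(** A one-point [P] would be definable, as the part of [E] not above that point. *)
Lemma not_singleton x : P x -> ~ (forall y, P y -> y = x).
Proof.
move=> Px sing; apply: (loc_nd hP).
have e z : P z <-> E z /\ ~ lt x z.
  split=> [Pz|[Ez nxz]].
    by split; [apply: (loc_PE hP)|rewrite (sing z Pz); apply: (lt_irr lin); apply: PD].
  have Dz := loc_ED hP Ez.
  have [->//|zx] := nlt_le lin (PD Px) Dz nxz.
  exact: (loc_init hP Px Ez zx).
apply: defin_ext (fun e0 => iff_sym (e (e0 0))) _.
apply: defin_and; first exact: defin_any (loc_E hP).
apply: defin_not; apply: defin2E (defin_any ltA) _ _; last exact: is_tm_var.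
exact: is_tm_cst.
Qed.

(** Automorphisms would carry a least element to every point, leaving a single point. *)
Lemma no_min x : P x -> exists2 y, P y & lt y x.
Proof.
move=> Px; apply: contrapT => nmin; apply: (not_singleton Px) => y Py.
have min z w : P z -> P w -> le z w.
  move=> Pz Pw; apply: (nlt_le lin); auto => wz.
  have [g gB gz] := loc_tr hP Pz Px; apply: nmin.
  by exists (act g w); [apply: aut_P|rewrite -gz; apply: aut_lt].
case: (min x y Px Py) => // xy; case: (min y x Py Px) => // yx.
by case: (lt_irr lin (PD Px)); apply: (lt_tr lin) yx; auto.
Qed.

Lemma loc_dich S : defin1 (allparams M) S -> large lt P S \/ large lt P (~` S).
Proof.
move=> /wom SC; apply: (large_dich lin (loc_pC hP)) => //; exact: (loc_ne hP).
Qed.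

Lemma loc_dich_rev S : defin1 (allparams M) S ->
  large (flip lt) P S \/ large (flip lt) P (~` S).
Proof.
move=> /wom/finconv_rev SC.
by apply: (large_dich (linear_order_on_rev lin) (loc_pC hP)) => //; exact: (loc_ne hP).
Qed.

Section Over.
Variables (B' : params M) (BB : sub_params B B') (sB : small K (par B')).

Let autB g : autfix B' g -> autfix B g.
Proof. exact: autfix_mono. Qed.

Lemma I_conj y y' : I B' P y -> I B' P y' -> exists2 g, autfix B' g & act g y = y'.
Proof.
apply: orb_conj => //; first by move=> S /defin_any/loc_dich.
by move=> g x /autB; apply: aut_P.
Qed.

Lemma I_large S y : defin1 B' S -> large lt P S -> I B' P y -> S y.
Proof.
move=> SB [c Pc cS] [Py /(_ _ Pc)[g gB gy]].
by apply/(defin1_aut _ gB SB); apply: cS gy; apply: aut_P => //; apply: autB.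
Qed.

Lemma I_P y : I B' P y -> P y. Proof. by case. Qed.
End Over.

Lemma gen_ex B' : sub_params B B' -> small K (par B') ->
  exists y, forall S, defin1 B' S -> large lt P S -> S y.
Proof.
move=> BB sB.
have [| | | |y yP] := @compactness _ _ _ hM G B'
    (fun S => defin1 B' S /\ large lt P S) sB.
- by move=> S [].
- split; first exact: defin_true.
  by have [c Pc] := loc_ne hP; exists c.
- move=> S S' [SB lS] [SB' lS']; split; first exact: defin_and.
  exact: (large_and lin).
- by move=> S [_ [c Pc cS]]; exists c; apply: cS => //; left.
- by exists y => S SB lS; apply: yP.
Qed.

Lemma gen_P B' y : sub_params B B' ->
  (forall S, defin1 B' S -> large lt P S -> S y) -> P y.
Proof.
move=> BB h; apply: (loc_td hP) => S SB PS; apply: h.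
  exact: defin_mono SB.
by have [c Pc] := loc_ne hP; exists c => // x Px _; apply: PS.
Qed.

(** A point generic over [B' +: c] lies at or below [c] and, by the dichotomy, has the same type
    over [B'] as [y]; homogeneity moves [y] to it. *)
Lemma gen_I B' y : sub_params B B' -> small K (par B') ->
  (forall S, defin1 B' S -> large lt P S -> S y) -> I B' P y.
Proof.
move=> BB sB h; split=> [|c Pc]; first exact: gen_P h.
have BBc : sub_params B' (B' +: c) by apply: sub_add.
have BB' : sub_params B (B' +: c) by move=> s x /BB; apply: BBc.
have [y' h'] := gen_ex BB' (small_add hM c sB).
have Py' := gen_P BB' h'.
have y'c : le y' c.
  apply: (nlt_le lin); auto; apply: (h' (fun x => ~ lt c x)).
    apply: defin_not; apply: defin2E (ltB BB') _ _; last exact: is_tm_var.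
    by apply: is_tm_cst; apply: in_add.
  exists c => // x Px xc cx; by apply: (lt_nle lin) cx xc; auto.
have [g gB gy] : exists2 g, autfix B' g & act g y = y'; last first.
  by exists g => //; rewrite gy.
apply: (homogeneity hM sB) => S SB Sy.
case: (loc_dich (defin_any SB)) => lS; last first.
  by have := h _ (defin_not SB) lS.
by apply: h' lS; apply: defin_mono SB.
Qed.

Lemma I_ex B' : sub_params B B' -> small K (par B') -> I B' P !=set0.
Proof.
by move=> BB sB; have [y h] := gen_ex BB sB; exists y; apply: gen_I h.
Qed.

Lemma I_sep B' y : sub_params B B' -> small K (par B') -> ~ I B' P y ->
  exists S, [/\ defin1 B' S, large lt P S & ~ S y].
Proof.
move=> BB sB nI; apply: contrapT => h; apply: nI; apply: gen_I => // S SB lS.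
by apply: contrapT => nS; apply: h; exists S.
Qed.

Lemma I_aut B' g y : sub_params B B' -> autfix B' g -> I B' P y -> I B' P (act g y).
Proof.
move=> BB gB [Py h]; split=> [|c /h[k kB ky]].
  by apply: aut_P => //; apply: autfix_mono gB.
have [g' [gB' gg' g'g]] := autfix_inv G gB.
exists (fun s x => k s (g' s x)); first exact: autfix_comp.
by have -> : act (fun s x => k s (g' s x)) (act g y) = act k y
  by rewrite -[in RHS](gg' y).
Qed.

Lemma I_low B' c : sub_params B B' -> small K (par B') -> P c ->
  exists2 y, I B' P y & le y c.
Proof.
move=> BB sB Pc; have [y Iy] := I_ex BB sB.
by have [g gB gy] := Iy.2 c Pc; exists (act g y) => //; apply: I_aut.
Qed.

Lemma I_init B' x y : sub_params B B' -> I B' P y -> P x -> le x y -> I B' P x.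
Proof.
move=> BB [Py h] Px xy; split=> // c Pc; have [g gB gy] := h c Pc.
have gB' := autfix_mono BB gB.
exists g => //; apply: (le_tr lin) gy; auto; try by apply: PD; apply: aut_P.
exact: aut_le.
Qed.

Lemma I_mono B' B'' y : sub_params B' B'' -> I B'' P y -> I B' P y.
Proof.
move=> BB [Py h]; split=> // c /h[g gB gy].
by exists g => //; apply: autfix_mono gB.
Qed.

Lemma I_td B' x : sub_params B B' -> small K (par B') ->
  (forall S, defin1 B' S -> I B' P `<=` S -> S x) -> I B' P x.
Proof.
move=> BB sB h; apply: gen_I => // S SB lS; apply: h => // y.
exact: I_large.
Qed.

Let sBx (x : X) : small K (par (B +: x)).
Proof. exact: small_add (loc_small hP). Qed.

Let BBx (x : X) : sub_params B (B +: x).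
Proof. exact: sub_add. Qed.

Lemma I_lt (x y : X) : P x -> I (B +: x) P y -> lt y x.
Proof.
move=> Px; apply: (@I_large _ (@BBx x) (fun z => lt z x)).
  apply: defin2E (ltB (@BBx x)) _ _; first exact: is_tm_var.
  by apply: is_tm_cst; apply: in_add.
have [c Pc cx] := no_min Px; exists c => // z Pz zc.
by apply: (le_lt_tr lin) zc cx; auto.
Qed.

Lemma I_act_over B1 g (x y : X) : sub_params B B1 -> autfix B1 g ->
  I (B1 +: x) P y -> I (B1 +: act g x) P (act g y).
Proof.
move=> BB1 gB [Py h]; have gB0 := autfix_mono BB1 gB.
split=> [|c Pc]; first exact: aut_P.
have [g' [gB' gg' g'g]] := autfix_inv G gB.
have [k kB ky] := h _ (aut_P (autfix_mono BB1 gB') Pc).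
(* The conjugate of [k] by [g] fixes [act g x] because [k] fixes [x]. *)
exists (fun s x => g s (k s (g' s x))).
  apply: autfix_add.
    apply: autfix_comp => //; apply: autfix_comp => //.
    by apply: autfix_mono kB; apply: sub_add.
  have -> : act (fun s x => g s (k s (g' s x))) (act g x) =
    act g (act k (act g' (act g x))) by [].
  by rewrite gg' (autfix_in kB) //; apply: in_add.
have -> : act (fun s x => g s (k s (g' s x))) (act g y) =
  act g (act k (act g' (act g y))) by [].
by rewrite gg' -(g'g c); apply: aut_le.
Qed.

Lemma I_act g (x y : X) : autfix B g -> I (B +: x) P y ->
  I (B +: act g x) P (act g y).
Proof. by apply: I_act_over => s z. Qed.

Lemma pair_conj (x y x' y' : X) : P x -> P x' -> I (B +: x) P y -> I (B +: x') P y' ->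
  exists g, [/\ autfix B g, act g x = x' & act g y = y'].
Proof.
move=> Px Px' xy xy'; have [g gB gx] := loc_tr hP Px Px'.
have := I_act gB xy; rewrite gx => xgy.
have [k kB ky] := I_conj (@BBx x') (sBx x') xgy xy'.
exists (fun s x => k s (g s x)); split.
- by apply: autfix_comp => //; apply: autfix_mono kB.
- have -> : act (fun s x => k s (g s x)) x = act k (act g x) by [].
  by rewrite gx (autfix_in kB) //; apply: in_add.
- by have -> : act (fun s x => k s (g s x)) y = act k (act g y) by [].
Qed.

(** Suppose all such [x] lie below [c], and take [w] above both [y] and [c]. By homogeneity [w] is
    in some [I (B +: x) P], which is initial and so contains [y]; then [x] is below [c], hence below
    [w], against [I_lt]. *)
Lemma O_ex (y c : X) : P y -> P c -> exists x, [/\ P x, le c x & I (B +: x) P y].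
Proof.
move=> Py Pc; apply: contrapT => ne.
have bd x : P x -> I (B +: x) P y -> lt x c.
  move=> Px xy; apply: (nle_lt lin); auto => cx; apply: ne; exists x; split=> //.
have [w [Pw yw cw]] : exists w, [/\ P w, le y w & le c w].
  case: (le_total lin (PD Py) (PD Pc)) => h; last by exists y; split=> //; left.
  by exists c; split=> //; left.
have [x Px xw] : exists2 x, P x & I (B +: x) P w.
  have [z Iz] := I_ex (@BBx y) (sBx y).
  have Pz := I_P Iz; have [g gB gz] := loc_tr hP Pz Pw.
  by exists (act g y); [apply: aut_P|rewrite -gz; apply: I_act].
have xy : I (B +: x) P y by apply: (I_init (@BBx x)) yw.
have xw' : lt x w by apply: (lt_le_tr lin) (bd _ Px xy) cw; auto.
exact: (lt_nle lin (PD Px) (PD Pw) xw' (or_intror (I_lt Px xw))).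
Qed.

(** By [O_ex] the orbit of [x] over [B +: y] is cofinal in [P], hence so is that of the larger [x'];
    [orb_conj] applies to the reversed order. *)
Lemma O_conj (x x' y : X) : P x -> P x' -> le x x' -> I (B +: x) P y ->
  exists2 g, autfix (B +: y) g & act g x = x'.
Proof.
move=> Px Px' xx' xy; have Py := I_P xy.
have autB g : autfix (B +: y) g -> autfix B g by apply: autfix_mono.
have ox c : P c -> exists2 g, autfix (B +: y) g & le c (act g x).
  move=> Pc; have [z [Pz cz zy]] := O_ex Py Pc.
  have [g [gB gx gy]] := pair_conj Px Pz xy zy.
  by exists g; [apply: autfix_add|rewrite gx].
apply: (@orb_conj (flip lt) (B +: y) P x x' (sBx y)).
- by move=> S /defin_any/loc_dich_rev.
- by move=> g z /autB; apply: aut_P.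
- split=> // c /ox[g gB cx]; exists g => //.
  by case: cx => [->|]; [left|right].
- split=> // c Pc; have [g gB cx] := ox c Pc; exists g => //.
  have : le c (act g x').
    apply: (le_tr lin) cx _; auto; try by apply: PD; apply: aut_P => //; apply: autB.
    by apply: aut_le xx'; apply: autB.
  by case=> [->|]; [left|right].
Qed.

Lemma O_final (x x' y : X) : P x -> P x' -> le x x' -> I (B +: x) P y ->
  I (B +: x') P y.
Proof.
move=> Px Px' xx' xy; have [g gB gx] := O_conj Px Px' xx' xy.
have := I_act (autfix_mono (@BBx y) gB) xy.
by rewrite gx (autfix_in gB) //; apply: in_add.
Qed.

End InLocus.
(** Otherwise every [B]-definable set containing [T] meets the complement of [Q], and saturation
    over [B] and the parameters of [Q] gives a point of [T] outside [Q]. *)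
Lemma td_compact B (T Q : set X) : small K (par B) ->
  (forall x, (forall S, defin1 B S -> T `<=` S -> S x) -> T x) ->
  defin1 (allparams M) Q -> T `<=` Q ->
  exists S, [/\ defin1 B S, T `<=` S & S `<=` Q].
Proof.
move=> sB td QM TQ; apply: contrapT => ne.
have [B' [BB fB QB]] := defin_fin B (defin_not QM).
have [||S S' [SB [S0 [S0B TS0 S0S]]] [SB' [S1 [S1B TS1 S1S]]]||x xP] :=
  @compactness _ _ _ hM G B' (fun S => defin1 B' S /\
    exists S0, [/\ defin1 B S0, T `<=` S0 & S0 `&` ~` Q `<=` S])
    (small_fin_over hM fB sB).
- by move=> S [].
- by split; [exact: defin_true|exists setT; split=> //; exact: defin_true].
- split; first exact: defin_and.
  exists (S0 `&` S1); split; first exact: defin_and.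
    by move=> x Tx; split; [apply: TS0|apply: TS1].
  by move=> x [[? ?] ?]; split; [apply: S0S|apply: S1S].
- move=> S [_ [S0 [S0B TS0 S0S]]]; apply: contrapT => S00.
  apply: ne; exists S0; split=> // x S0x; apply: contrapT => nQ.
  by apply: S00; exists x; apply: S0S.
- apply: (xP (~` Q)).
    by split=> //; exists setT; split=> //; exact: defin_true.
  apply: TQ; apply: td => S SB TS; apply: (xP S).
  split; first exact: defin_mono SB.
  by exists S; split=> // y [].
Qed.

(** * The case of triples *)

Section Triples.
Variables (B : params M) (E P : set X) (hP : locus B E P).

Let PE x : P x -> E x. Proof. by move=> /(loc_PE hP). Qed.
Let ED x : E x -> D x. Proof. by move=> /(loc_ED hP). Qed.
Let PD x : P x -> D x. Proof. by move=> /PE/ED. Qed.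
#[local] Hint Resolve PE ED PD : core.
Let EB : defin1 B E. Proof. exact: loc_E hP. Qed.
Let ltB : defin2 B lt. Proof. by apply: defin_mono ltA; apply: loc_A hP. Qed.
Let sBx (x : X) : small K (par (B +: x)).
Proof. exact: small_add (loc_small hP). Qed.
Let BBx (x : X) : sub_params B (B +: x).
Proof. exact: sub_add. Qed.

Let Pdown x y : P x -> E y -> ~ lt x y -> P y.
Proof.
move=> Px Ey /(nlt_le lin (PD Px) (ED Ey))[->//|]; exact: (loc_init hP).
Qed.

Let lt_asym x y : D x -> D y -> lt x y -> ~ lt y x.
Proof.
by move=> Dx Dy xy yx; apply: (lt_irr lin Dx); apply: (lt_tr lin) yx; auto.
Qed.

(** The uniform family of initial segments that a failure of [I_triple] produces. *)
Definition family (R : X -> X -> X -> Prop) :=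
  [/\ defin3 B R,
    forall y x z w, R y x z -> E w -> ~ lt z w -> R y x w,
    forall y x, P y -> I (B +: y) P x -> exists2 z, P z & R y x z
  & forall y x, P y -> I (B +: y) P x -> exists2 z, I (B +: x) P z & ~ R y x z].

(** A set over [a0] and [a1] contains an initial part of [P] but omits [a2]; conjugacy of pairs
    spreads this to all [y] and [x]. *)
Lemma family_ex a0 a1 a2 : P a0 -> I (B +: a0) P a1 -> I (B +: a1) P a2 ->
  ~ I (B +: a0 +: a1) P a2 -> exists R, family R.
Proof.
move=> P0 I1 I2 nI.
have sub : sub_params B (B +: a0 +: a1) by move=> s x h; do 2 left.
have [S [SB [c Pc cS] nS]] := I_sep hP sub (small_add hM a1 (sBx a0)) nI.
have [r rB rP] := defin1_extract2 SB.
(* The largest initial segment of [E] inside [r y x]. The definable [E] stands in for [P], which is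
   not definable. *)
pose R y x z := E z /\ forall w, E w -> ~ lt z w -> r y x w.
have RB : defin3 B R.
  by dfn.
exists R; split=> //.
- move=> y x z w [Ez h] Ew wz; split=> // v Ev vw; apply: h => // zv.
  have := nlt_le lin (ED Ez) (ED Ew) wz; have := nlt_le lin (ED Ew) (ED Ev) vw.
  by move=> h1 h2; apply: (lt_nle lin) zv (le_tr lin _ _ _ h1 h2); auto.
- move=> y x Py Ix; have [g [gB <- <-]] := pair_conj hP P0 Py I1 Ix.
  exists (act g c); first exact: (aut_P hP).
  apply/(defin3_aut _ _ _ gB RB); split; first exact: PE.
  move=> w Ew cw; apply/rP; apply: cS; first exact: Pdown Ew cw.
  by apply: (nlt_le lin); auto.
- move=> y x Py Ix; have [g [gB <- <-]] := pair_conj hP P0 Py I1 Ix.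
  exists (act g a2); first exact: (I_act hP).
  move=> /(defin3_aut _ _ _ gB RB)[E2 h]; apply: nS; apply/rP; apply: h => //.
  by apply: (lt_irr lin); auto.
Qed.

Section Family.
Variable R : X -> X -> X -> Prop.
Hypothesis fR : family R.

Let RB : defin3 B R. Proof. by case: fR. Qed.
Let Rdown y x z w : R y x z -> E w -> ~ lt z w -> R y x w.
Proof. by case: fR => _ h _ _; apply: h. Qed.
Let Rex y x : P y -> I (B +: y) P x -> exists2 z, P z & R y x z.
Proof. by case: fR => _ _ h _; apply: h. Qed.
Let Rnex y x : P y -> I (B +: y) P x -> exists2 z, I (B +: x) P z & ~ R y x z.
Proof. by case: fR => _ _ _ h; apply: h. Qed.

(* For fixed y, the unions of the sets R y x' over x' <= x and over x' >= x are
   comparable initial segments of P; by homogeneity, the comparison does not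
   depend on x, and letting x tend to the left end decides it. *)
Lemma family_cofinal y x0 x z : P y -> I (B +: y) P x0 -> I (B +: y) P x -> P z ->
  R y x0 z -> exists x', [/\ I (B +: y) P x', le x x' & R y x' z].
Proof.
move=> Py I0 Ix Pz R0; apply: contrapT => ne.
have P0 := I_P I0; have Px := I_P Ix.
have [x2 [P2 x20 x2z]] : exists x2, [/\ P x2, le x2 x0 & le x2 z].
  case: (le_total lin (PD P0) (PD Pz)) => h; first by exists x0; split=> //; left.
  by exists z; split=> //; left.
have I2 : I (B +: y) P x2 by apply: (I_init hP (@BBx y) I0).
have [g gB gx] := I_conj hP (@BBx y) (sBx y) Ix I2.
have gB' := autfix_mono (@BBx y) gB.
have gy : act g y = y by apply: (autfix_in gB); apply: in_add.
have Pgz := aut_P hP gB' Pz.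
have x0x : lt x0 x.
  by apply: (nle_lt lin); auto => xx0; apply: ne; exists x0.
(* If [act g z] were at or below [z], it would be in [R y x0]; the inverse of [g] then takes [x0] to
   a point at or above [x] whose set contains [z]. *)
have zgz : lt z (act g z).
  apply: contrapT => n.
  have [g' [gB1 gg' g'g]] := autfix_inv G gB.
  have R1 : R y x0 (act g z) by apply: Rdown R0 _ n; auto.
  apply: ne; exists (act g' x0); split.
  - exact: (I_aut hP (@BBx y)).
  - have e : act g' x2 = x by rewrite -gx gg'.
    by rewrite -e; apply: (aut_le hP) x20; apply: autfix_mono gB1.
  - have := (defin3_aut y x0 (act g z) (autfix_mono (@BBx y) gB1) RB).2 R1.
    by rewrite gg' (autfix_in gB1) //; apply: in_add.
have Ig := I_aut hP (@BBx y) gB I0.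
(* Now [R y (act g x0)] contains [z], which is above [act g x0], and so contains all of
   [I (B +: act g x0) P], against [Rnex]. *)
have Rg : R y (act g x0) z.
  have := (defin3_aut y x0 z gB' RB).2 R0; rewrite gy => h.
  by apply: Rdown h _ _; auto; apply: lt_asym; auto.
have [z' Iz' nR] := Rnex Py Ig; apply: nR; apply: Rdown Rg _ _.
  by apply: PE; apply: I_P Iz'.
have Pg := I_P Ig; have Pz' := I_P Iz'.
apply: lt_asym; auto; apply: (lt_tr lin _ _ _ (I_lt hP Pg Iz')); auto.
apply: (lt_le_tr lin _ _ _ _ x2z); auto.
by rewrite -gx; apply: (aut_lt hP).
Qed.

(** For fixed [z], weak o-minimality makes [R y x z] eventually true or eventually false as [x]
    grows in [I (B +: y) P]; [family_cofinal] excludes the latter. *)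
Lemma family_eventual y : P y -> exists x1 z, [/\ I (B +: y) P x1, P z &
  forall x, I (B +: y) P x -> le x1 x -> R y x z].
Proof.
move=> Py; have [x0 I0] := I_ex hP (@BBx y) (sBx y).
have [z Pz Rz] := Rex Py I0.
have SM : defin1 (allparams M) (fun x => R y x z).
  have RM : defin3 (allparams M) R := defin_any RB.
  by dfn.
have := large_dich (linear_order_on_rev lin) (P := orb lt (B +: y) P) _ pD _
  (finconv_rev (wom SM)).
case.
- by move=> x /I_P/(loc_pC hP).
- by exists x0.
- move=> [x1 I1 h]; exists x1, z; split=> // x Ix x1x; apply: h => //.
  by case: x1x => [->|]; [left|right].
- move=> [x1 I1 h].
  have [x [Ix x1x Rx]] := family_cofinal Py I0 I1 Pz Rz.
  by case: (h x) => //; case: x1x => [->|]; [left|right].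
Qed.

(** Intersecting the sets [R y x'] over [x'] at or above [x] gives sets increasing in [x]. Since
    [I (B +: y) P] may fail to be definable, [x'] ranges over a definable superset [H2 y], which
    [td_compact] makes small enough for the intersection still to meet [P]. *)
Lemma family_monotone : exists2 R', family R' &
  forall y x x' z, P x -> P x' -> le x x' -> R' y x z -> R' y x' z.
Proof.
have [y0 P0] := loc_ne hP.
have [x1 [z1 [I1 Pz1 ev]]] := family_eventual P0.
have P1 := I_P I1.
have QM : defin1 (allparams M) (fun x => E x -> ~ lt x x1 -> R y0 x z1).
  have RM : defin3 (allparams M) R := defin_any RB.
  have ltM := defin_any ltB; have EM := defin_any EB.
  by dfn.
have [|H [HB IH HQ]] := td_compact (sBx y0) (fun x => @I_td B E P hP _ x (@BBx y0) (sBx y0)) QM.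
  move=> x Ix Ex xx1; apply: ev => //; apply: (nlt_le lin); auto.
have [H2 H2B HP] := defin1_extract HB.
have IH2 y x : P y -> I (B +: y) P x -> H2 y x.
  move=> Py Ix; have [g gB gy] := loc_tr hP Py P0.
  have := I_act hP gB Ix; rewrite gy => /IH/HP; rewrite -gy.
  by move/(defin2_aut y x gB H2B).
pose R' y x z := E z /\ forall x', E x' -> H2 y x' -> ~ lt x' x -> R y x' z.
have RB' : defin3 B R' by dfn.
exists R'; first split=> //.
- move=> y x z w [Ez h] Ew wz; split=> // x' Ex' Hx' xx'.
  by apply: Rdown wz => //; apply: h.
- move=> y x Py Ix; have [g [gB <- <-]] := pair_conj hP P0 Py I1 Ix.
  exists (act g z1); first exact: (aut_P hP).
  apply/(defin3_aut _ _ _ gB RB'); split; first exact: PE.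
  by move=> x' Ex' /HP Hx' n; apply: HQ.
- move=> y x Py Ix; have [z Iz nR] := Rnex Py Ix; exists z => // -[Ez h].
  have Px := I_P Ix.
  by apply: nR; apply: h; auto; apply: (lt_irr lin); auto.
- move=> y x x' z Px Px' xx' [Ez h]; split=> // w Ew Hw wx'; apply: h => // wx.
  by apply: wx'; apply: (lt_le_tr lin) wx xx'; auto.
Qed.

(* The upper cut of P is not definable, so that a property of all the elements
   of P above h spills over to an element of E above P. *)
Lemma family_overspill x h : P x -> P h ->
  (forall y, P y -> lt h y -> exists z, [/\ E z, ~ lt x z &
     forall y', E y' -> lt h y' -> ~ lt y y' -> R y' x z]) ->
  exists2 z, I (B +: x) P z & forall y, P y -> lt h y -> R y x z.
Proof.
move=> Px Ph hA.
pose Y y := E y /\ exists z, (E z /\ ~ lt x z) /\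
   forall y', E y' -> lt h y' -> ~ lt y y' -> R y' x z.
have YM : defin1 (allparams M) Y.
  have RM : defin3 (allparams M) R := defin_any RB.
  have ltM := defin_any ltB; have EM := defin_any EB.
  by dfn.
have PY : P `<=` Y.
  move=> y Py; split; first exact: PE.
  case: (EM (lt h y)) => [/(hA _ Py)[z [Ez xz hz]]|nhy]; first by exists z.
  exists x; split; first by split; [apply: PE|apply: (lt_irr lin); auto].
  move=> y' Ey' hy' yy'; case: nhy; apply: (lt_le_tr lin) hy' _; auto.
  by apply: (nlt_le lin); auto.
(* No point of [P] is above such a [y], so its one witness [z] serves all of [P] above [h]. *)
have [y [[Ey [z [[Ez xz] hz]]] nPy]] : exists y, Y y /\ ~ P y.
  apply: contrapT => n; apply: (loc_nd hP).
  have e : P = Y.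
    apply/seteqP; split=> // y Yy; apply: contrapT => nP; apply: n; by exists y.
  by rewrite e.
have Pz := Pdown Px Ez xz.
have [z' Iz' z'z] := I_low hP (@BBx x) (sBx x) Pz.
exists z' => // y' Py' hy'; have Pz' := I_P Iz'.
apply: Rdown (hz y' _ hy' _) _ _; auto.
- by move=> yy'; apply: nPy; apply: (loc_init hP Py').
- by move=> zz'; apply: (lt_nle lin) zz' z'z; auto.
Qed.

(* If R y' x z failed for some y' in each of the intervals between infinitely
   many points of P, then taking z low enough that R holds at arbitrarily many
   of these points would contradict weak o-minimality, uniformly in z by
   homogeneity. *)
Lemma family_bound x : P x -> exists h z, [/\ P h, I (B +: x) P z &
  forall y, P y -> lt h y -> R y x z].
Proof.
move=> Px; apply: contrapT => ne.
(* Overspill, negated, gives one [y] for all [z] at once, so the points [h i] can be chosen before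
   [z]. *)
have next h : exists y, P h -> I (B +: h) P x -> [/\ P y, lt h y &
    forall z, E z -> ~ lt x z -> exists y',
      [/\ E y', lt h y', ~ lt y y' & ~ R y' x z]].
  case: (EM (P h /\ I (B +: h) P x)) => [[Ph Ih]|n]; last first.
    by exists h => Ph Ih; case: n.
  apply: contrapT => n; apply: ne; exists h.
  have [|z Iz hz] := @family_overspill x h Px Ph.
    move=> y Py hy; apply: contrapT => n'; apply: n; exists y => _ _; split=> //.
    move=> z Ez xz; apply: contrapT => n''; apply: n'; exists z; split=> //.
    move=> y' Ey' hy' yy'; apply: contrapT => nR.
    by apply: n''; exists y'.
  by exists z.
have [f fP] := choice next.
have [h0 [Ph0 _ Ih0]] := O_ex hP Px Px.
pose h i := iter i f h0.
have hO i : P (h i) /\ I (B +: h i) P x.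
  elim: i => [//|i [Pi Ii]]; have [Pf hf _] := fP _ Pi Ii.
  by split=> //; apply: (O_final hP Pi) Ii => //; right.
(* The bound [n] is fixed for [z0]. The [z] chosen below depends on [n] and is moved to [z0] by an
   automorphism over [B +: x]. *)
have [z0 I0] := I_ex hP (@BBx x) (sBx x).
have SM : defin1 (allparams M) (fun y => ~ R y x z0).
  have RM : defin3 (allparams M) R := defin_any RB.
  by dfn.
have [n nalt] := no_alternation lin pD (wom SM).
(* The indices go up to [n.+1]: since [R] holds at [h i.+1] and fails at [u i], these points differ,
   also for [i = n]. *)
have [z Iz hz] : exists2 z, I (B +: x) P z &
    forall i, (i <= n.+1)%N -> R (h i) x z.
  elim: (n.+1) => [|m [z Iz hz]].
    have [z Pz Rz] := Rex (hO 0).1 (hO 0).2.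
    have [z' Iz' zz'] := I_low hP (@BBx x) (sBx x) Pz.
    exists z' => // i; rewrite leqn0 => /eqP ->; have Pz' := I_P Iz'.
    by apply: Rdown Rz _ _; auto => h'; apply: (lt_nle lin) h' zz'; auto.
  have [w Pw Rw] := Rex (hO m.+1).1 (hO m.+1).2; have Pz := I_P Iz.
  have [v [Pv vz vw]] : exists v, [/\ P v, le v z & le v w].
    case: (le_total lin (PD Pz) (PD Pw)) => h'; first by exists z; split=> //; left.
    by exists w; split=> //; left.
  exists v; first exact: (I_init hP (@BBx x) Iz).
  move=> i; rewrite leq_eqVlt => /orP[/eqP ->|/hz Ri].
    by apply: Rdown Rw _ _; auto => h'; apply: (lt_nle lin) h' vw; auto.
  by apply: Rdown Ri _ _; auto => h'; apply: (lt_nle lin) h' vz; auto.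
have Pz := I_P Iz.
have ux i : exists y, [/\ E y, lt (h i) y, ~ lt (h i.+1) y & ~ R y x z].
  have [_ _ hf] := fP _ (hO i).1 (hO i).2; apply: hf; auto.
  by apply: lt_asym; auto; apply: (I_lt hP).
have [u uP] := choice ux.
have Pu i : P (u i).
  by have [Eu _ hu _] := uP i; apply: Pdown hu => //; apply: (hO _).1.
have [g gB gz] := I_conj hP (@BBx x) (sBx x) Iz I0.
have gB' := autfix_mono (@BBx x) gB.
have gx : act g x = x by apply: (autfix_in gB); apply: in_add.
have gR y : R (act g y) x z0 <-> R y x z.
  by rewrite -(defin3_aut y x z gB' RB) gx gz.
have PpC y : P y -> pC y by move=> /(loc_pC hP).
apply: (nalt (fun i => act g (h i)) (fun i => act g (u i))) => i lei.
- have [Eu hu uh nR] := uP i; split.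
  + by apply: PpC; apply: (aut_P hP) => //; apply: (hO i).1.
  + by apply: PpC; apply: (aut_P hP).
  + exact: (aut_lt hP).
  + apply: (aut_lt hP) => //.
    have := nlt_le lin (PD (hO i.+1).1) (ED Eu) uh; case=> // e.
    by case: nR; rewrite e; apply: hz.
- by rewrite gR; have [] := uP i.
- by rewrite gR => n'; apply: n'; apply: hz; apply: leqW.
Qed.

End Family.

Lemma I_triple a0 a1 a2 : P a0 -> I (B +: a0) P a1 -> I (B +: a1) P a2 ->
  I (B +: a0 +: a1) P a2.
Proof.
move=> P0 I1 I2; apply: contrapT => nI.
have [R0 /family_monotone[R fR Rmono]] := family_ex P0 I1 I2 nI.
have [h [z [Ph Iz hz]]] := family_bound fR P0.
(* Here [a0] is the smaller middle point, [x] the larger one and [w] the top point, at which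
   [R w a0] is compared with [R w x]. *)
have [x [Px hx ax]] : exists x, [/\ P x, le h x & le a0 x].
  case: (le_total lin (PD Ph) (PD P0)) => h'; first by exists a0; split=> //; left.
  by exists h; split=> //; left.
have Ixz : I (B +: x) P z by apply: (O_final hP P0) Iz.
(* The family omits some [z'] at [a0] and [a1]. The pair of [a1] and [z'] is conjugate to that of
   [x] and [z], and [w] is the image of [a0]. *)
have [w [Iw nR]] : exists w, I (B +: w) P x /\ ~ R w x z /\ P w.
  have [_ _ _ Rnex] := fR.
  have [z' Iz' nR] := Rnex _ _ P0 I1; have P1 := I_P I1.
  have [g [gB gx gz]] := pair_conj hP P1 Px Iz' Ixz.
  exists (act g a0); split; first by rewrite -gx; apply: (I_act hP).
  split; last exact: (aut_P hP).
  case: fR => RB _ _ _.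
  by rewrite -gx -gz => /(defin3_aut _ _ _ gB RB).
case: nR => nR Pw; apply: nR; apply: (Rmono w a0) => //; apply: hz => //.
by apply: (le_lt_tr lin _ _ _ hx (I_lt hP Pw Iw)); auto.
Qed.

End Triples.

(** * Loci over one more parameter *)

Section SubLoci.
Variables (B : params M) (E P : set X) (hP : locus B E P).

Let PE x : P x -> E x. Proof. by move=> /(loc_PE hP). Qed.
Let ED x : E x -> D x. Proof. by move=> /(loc_ED hP). Qed.
Let PD x : P x -> D x. Proof. by move=> /PE/ED. Qed.
#[local] Hint Resolve PE ED PD : core.
Let sBx (x : X) : small K (par (B +: x)).
Proof. exact: small_add (loc_small hP). Qed.
Let BBx (x : X) : sub_params B (B +: x).
Proof. exact: sub_add. Qed.

Let Pdown x y : P x -> E y -> ~ lt x y -> P y.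
Proof.
move=> Px Ey /(nlt_le lin (PD Px) (ED Ey))[->//|]; exact: (loc_init hP).
Qed.

Lemma I_subset B' P' y : P' `<=` P -> P' y -> I B' P y -> I B' P' y.
Proof. by move=> PP Py [_ h]; split=> // c /PP/h. Qed.

(** Taking [Q] to be the set itself in [td_compact] shows that it is definable over [B +: x0];
    transitivity on [P] makes the definition uniform. *)
Lemma I_definable x0 : P x0 -> defin1 (allparams M) (I (B +: x0) P) ->
  exists2 psi, defin2 B psi & forall x y, P x -> (I (B +: x) P y <-> psi x y).
Proof.
move=> P0 ID.
have [//|S [SB IS SI]] := td_compact (sBx x0)
  (fun x => @I_td B E P hP _ x (@BBx x0) (sBx x0)) ID.
have [psi psiB psiP] := defin1_extract SB; exists psi => // x y Px.
have [g gB gx] := loc_tr hP Px P0; rewrite -(defin2_aut x y gB psiB) gx.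
split=> [/(I_act hP gB)|/psiP/SI h]; first by rewrite gx => /IS/psiP.
have [g' [gB' gg' _]] := autfix_inv G gB.
by have := I_act hP gB' h; rewrite -gx !gg'.
Qed.

(** The set is initial in [P], so the same [E] serves. *)
Lemma locus_I c : P c -> ~ defin1 (allparams M) (I (B +: c) P) ->
  locus (B +: c) E (I (B +: c) P).
Proof.
move=> Pc nd; split=> //.
- by move=> s x /(loc_A hP); apply: BBx.
- by apply: defin_mono (loc_E hP); apply: BBx.
- by move=> x /I_P/PE.
- move=> x y Ix Ey yx; apply: (I_init hP (@BBx c) Ix); last by right.
  exact: (loc_init hP (I_P Ix)).
- by move=> x /I_P/(loc_pC hP).
- exact: (I_ex hP).
- by move=> x; apply: (I_td hP).
- exact: (I_conj hP).
Qed.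

(** A final segment of [P] by [O_final], so its upper cut is that of [P]. *)
Definition above c x := P x /\ I (B +: x) P c.

(** The upward closure in [E] of the solutions of [psi] in its first variable, at [c], serves as
    [E']. If [above c] were definable, so would be its downward closure in [E], which is [P]. *)
Lemma locus_O psi c : P c -> defin2 B psi ->
  (forall x y, P x -> (I (B +: x) P y <-> psi x y)) ->
  exists E', locus (B +: c) E' (above c).
Proof.
move=> Pc psiB psiP.
have psiB' : defin2 (B +: c) psi by apply: defin_mono psiB.
have EB' : defin1 (B +: c) E by apply: defin_mono (loc_E hP).
have AB : sub_params A (B +: c) by move=> s x /(loc_A hP); apply: BBx.
have ltB' : defin2 (B +: c) lt := defin_mono AB ltA.
exists (fun y => E y /\ exists y', E y' /\ ~ lt y y' /\ psi y' c); split=> //.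
- by dfn.
- by move=> y [/ED].
- move=> x [Px Ix]; split; first exact: PE.
  exists x; split; first exact: PE.
  by split; [apply: (lt_irr lin); auto|apply/psiP].
- move=> x y [Px Ix] [Ey [y' [Ey' [yy' psiy']]]] yx.
  have Py := loc_init hP Px Ey yx; split=> //.
  have Py' := Pdown Py Ey' yy'.
  apply: (O_final hP Py' Py); last by apply/psiP.
  by apply: (nlt_le lin); auto.
- by move=> x [/(loc_pC hP)].
- by have [x [Px _ Ix]] := O_ex hP Pc Pc; exists x.
- move=> x h.
  have Px : P x.
    apply: (loc_td hP) => S SB PS; apply: h; first exact: defin_mono SB.
    by move=> y [/PS].
  split=> //; apply/psiP => //; apply: (h (fun x => psi x c)).
    by dfn.
  by move=> y [Py /psiP]; apply.
- move=> x x' [Px Ix] [Px' Ix'].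
  have [g [gB gx gc]] := pair_conj hP Px Px' Ix Ix'.
  by exists g => //; apply: autfix_add.
- move=> OD; apply: (loc_nd hP).
  have EM := defin_any (loc_E hP); have ltM := defin_any ltA.
  have : defin1 (allparams M) (fun z => E z /\ exists y, above c y /\ ~ lt y z).
    by dfn.
  apply: defin_ext => e; split=> [[Ez [y [[Py _] yz]]]|Pz].
    exact: Pdown Ez yz.
  split; first exact: PE.
  have [y [Py zy Iy]] := O_ex hP Pc Pz; exists y; split=> // yz.
  by apply: (lt_nle lin) yz zy; auto.
Qed.

(** Take [y'] below [y] and generic over [B +: c +: x]. By [I_triple] the triples [x, y', c] and
    [x, y, c] are conjugate over [B], so [y'] moves to [y] with [c] and [x] fixed. *)
Lemma I_above E' c x y : locus (B +: c) E' (above c) -> above c x -> above c y ->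
  I (B +: x) P y -> I (B +: c +: x) (above c) y.
Proof.
move=> hO [Px Ix] [Py Iy] Ixy.
have Bcx : sub_params (B +: c) (B +: c +: x) by apply: sub_add.
have Bc : P c by apply: I_P Ix.
have [y' Iy' y'y] := I_low hO Bcx (small_add hM x (sBx c)) (conj Py Iy).
have [Py' Iy'c] := I_P Iy'.
have Ixy' : I (B +: x) P y' by apply: (I_init hP (@BBx x) Ixy).
have [g gB gy'] := I_conj hP (@BBx x) (sBx x) Ixy' Ixy.
have := I_act_over hP (@BBx x) gB (I_triple hP Px Ixy' Iy'c); rewrite gy' => Igc.
have Bxy : sub_params B (B +: x +: y) by move=> s z h; do 2 left.
have [k kB kgc] := I_conj hP Bxy (small_add hM y (sBx x)) Igc (I_triple hP Px Ixy Iy).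
pose f := fun s z => k s (g s z).
have fE z : act f z = act k (act g z) by [].
have fB : autfix B f.
  by apply: autfix_comp; [apply: autfix_mono kB|apply: autfix_mono gB].
have fB' : autfix (B +: c +: x) f.
  apply: autfix_add; first exact: autfix_add.
  rewrite fE (autfix_in gB); last exact: in_add.
  by rewrite (autfix_in kB) //; apply: in_sub (@in_add _ _ _ _ _); apply: sub_add.
have fy : act f y' = y.
  by rewrite fE gy' (autfix_in kB) //; apply: in_add.
by rewrite -fy; apply: (I_aut hO).
Qed.

End SubLoci.

(** * Finite descending sequences *)

Definition pairwise B P n (a : nat -> X) :=
  (forall i, (i < n)%N -> P (a i)) /\
  (forall i j, (i < j < n)%N -> I (B +: a i) P (a j)).

Lemma pairwise_act B E P n g a : locus B E P -> autfix B g ->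
  pairwise B P n a -> pairwise B P n (fun i => act g (a i)).
Proof.
move=> hP gB [aP aI]; split=> [i /aP|i j /aI]; first exact: (aut_P hP).
exact: (I_act hP).
Qed.

(* For longer tuples, one coordinate c is added to the parameters: I (B +: c) P
   keeps the lower cut of P, and the elements above c its upper cut; if the
   former has a definable upper cut then the latter has a definable lower cut,
   so that at least one of the two is again of mixed kind. *)
Lemma pairwise_conj n B E P a b : locus B E P -> pairwise B P n a ->
  pairwise B P n b ->
  exists2 g, autfix B g & forall i, (i < n)%N -> act g (a i) = b i.
Proof.
elim: n B E P a b => [|n IH] B E P a b hP ha hb.
  by exists (fun s x => x) => //; apply: autfix_id.
have BBx (x : X) : sub_params B (B +: x) by apply: sub_add.
have sBx (x : X) : small K (par (B +: x)) by apply: small_add (loc_small hP).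
(* Lengths 1, 2 and 3 are direct, the last by [I_triple]; from length 4 on, one coordinate joins the
   parameters. *)
case: n => [|[|[|n]]] in IH ha hb *.
- have [g gB ga] := loc_tr hP (ha.1 0 isT) (hb.1 0 isT).
  by exists g => // -[].
- have [g [gB g0 g1]] := pair_conj hP (ha.1 0 isT) (hb.1 0 isT)
    (ha.2 0 1 isT) (hb.2 0 1 isT).
  by exists g => // -[|[]].
- have [g [gB g0 g1]] := pair_conj hP (ha.1 0 isT) (hb.1 0 isT)
    (ha.2 0 1 isT) (hb.2 0 1 isT).
  have h2 := I_act hP gB (ha.2 1 2 isT); rewrite g1 in h2.
  have Bxy : sub_params B (B +: b 0 +: b 1) by move=> s z h; do 2 left.
  have [k kB k2] := I_conj hP Bxy (small_add hM (b 1) (sBx (b 0)))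
    (I_triple hP (hb.1 0 isT) (hb.2 0 1 isT) h2)
    (I_triple hP (hb.1 0 isT) (hb.2 0 1 isT) (hb.2 1 2 isT)).
  exists (fun s x => k s (g s x)).
    by apply: autfix_comp => //; apply: autfix_mono kB.
  have E' z : act (fun s x => k s (g s x)) z = act k (act g z) by [].
  case=> [|[|[|//]]] _; rewrite E' ?g0 ?g1 //; apply: (autfix_in kB).
    by apply: in_sub (@in_add _ _ _ _ _); apply: sub_add.
  exact: in_add.
(* In the definable case the last coordinate is adjoined and the others lie above it; otherwise the
   first is adjoined. *)
case: (EM (defin1 (allparams M) (I (B +: b 0) P))) => [ID|nID].
  have [psi psiB psiP] := I_definable hP (hb.1 0 isT) ID.
  pose m := n.+3; have mm : (m < m.+1)%N by [].
  have [E' hO] := locus_O hP (hb.1 m mm) psiB psiP.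
  have [g gB gm] := loc_tr hP (ha.1 m mm) (hb.1 m mm).
  have hga := pairwise_act hP gB ha.
  have sub c : pairwise B P m.+1 c -> c m = b m -> pairwise (B +: b m) (above B P (b m)) m c.
    move=> hc cm; have Oc i : (i < m)%N -> above B P (b m) (c i).
      by move=> im; split; [apply: hc.1; apply: ltnW|rewrite -cm; apply: hc.2; rewrite im mm].
    split=> // i j /andP[ij jm]; apply: (I_above hP hO).
    - by apply: Oc; apply: ltn_trans ij jm.
    - exact: Oc.
    - by apply: hc.2; rewrite ij ltnW.
  have [k kB kE] := IH _ _ _ _ _ hO (sub _ hga gm) (sub _ hb erefl).
  exists (fun s x => k s (g s x)).
    by apply: autfix_comp => //; apply: autfix_mono kB.
  move=> i; have -> : act (fun s x => k s (g s x)) (a i) = act k (act g (a i)) by [].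
  rewrite ltnS leq_eqVlt => /orP[/eqP ->|/kE //].
  by rewrite gm (autfix_in kB) //; apply: in_add.
have hI := locus_I hP (hb.1 0 isT) nID.
have [g gB g0] := loc_tr hP (ha.1 0 isT) (hb.1 0 isT).
have hga := pairwise_act hP gB ha.
have sub c : pairwise B P n.+4 c -> c 0 = b 0 ->
    pairwise (B +: b 0) (I (B +: b 0) P) n.+3 (fun i => c i.+1).
  move=> hc c0; have Ic i : (i < n.+3)%N -> I (B +: b 0) P (c i.+1).
    by move=> im; rewrite -c0; apply: hc.2; rewrite !ltnS.
  split=> // i j /andP[ij jm]; apply: (@I_subset P).
  - by move=> x /I_P.
  - exact: Ic.
  - apply: (I_triple hP (hb.1 0 isT)); first by apply: Ic; apply: ltn_trans ij jm.
    by apply: hc.2; rewrite !ltnS ij.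
have [k kB kE] := IH _ _ _ _ _ hI (sub _ hga g0) (sub _ hb erefl).
exists (fun s x => k s (g s x)).
  by apply: autfix_comp => //; apply: autfix_mono kB.
move=> i; have -> : act (fun s x => k s (g s x)) (a i) = act k (act g (a i)) by [].
case: i => [_|i]; last by rewrite ltnS => /kE.
by rewrite g0 (autfix_in kB) //; apply: in_add.
Qed.

Section Final.
Variables (E P : set X) (hP : locus A E P).

(** Let [b] be generic over all earlier terms. Replacing [a i] by [b] keeps the sequence pairwise
    generic, so [pairwise_conj] moves [b] to [a i] while fixing the earlier terms. *)
Lemma pairwise_morley (a : nat -> X) : (forall i, P (a i)) ->
  (forall i j, (i < j)%N -> forall S, defin1 (A +: a i) S -> large lt P S -> S (a j)) ->
  forall i S, defin1 (add_params A [set a j | j in `I_i]) S -> large lt P S -> S (a i).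
Proof.
move=> aP aI i S.
pose B n := add_params A [set a j | j in `I_n].
have AB n : sub_params A (B n) by apply: sub_add.
have sA : small K (par A) := loc_small hP.
have sB n : small K (par (B n)).
  elim: n => [|n IH].
    apply: (small_sub hM _ sA) => s x [//|[y [j]]].
    by rewrite /= ltn0.
  apply: (small_sub hM _ (small_add hM (a n) IH)) => s x [Ax|]; first by do 2 left.
  move=> [_ [j /= + <-] xv]; rewrite ltnS leq_eqVlt => /orP[/eqP <-|jn].
    by right; exists (a j).
  by left; right; exists (a j) => //; exists j.
have aI' j k : (j < k)%N -> I (A +: a j) P (a k).
  move=> jk; apply: (gen_I hP); first exact: sub_add.
    exact: (small_add hM).
  exact: aI.
have [b Ib] := I_ex hP (AB i) (sB i).
pose c k := if (k < i)%N then a k else b.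
have aB j : (j < i)%N -> in_params (B i) (a j).
  by move=> ji s v; right; exists (a j); [exists j|exists v].
have hc : pairwise A P i.+1 c.
  split=> [k ki|j k /andP[jk ki]]; rewrite /c.
    by case: ifP => // _; apply: I_P Ib.
  rewrite (leq_trans jk ki); case: ifP => [_|_]; first exact: aI'.
  apply: I_mono Ib => s x [/AB//|[_ /= -> [v <-]]].
  by apply: aB; apply: leq_trans jk ki.
have ha : pairwise A P i.+1 a by split=> // j k /andP[jk _]; apply: aI'.
have [g gA ga] := pairwise_conj hP hc ha.
have gB : autfix (B i) g.
  split; first by case: gA.
  move=> s x [Ax|[_ [j /= ji <-] [v <-]]]; first by case: gA => _; apply.
  have e : act g (a j) = a j by have := ga j (ltnW ji); rewrite /c ji.
  by rewrite -[in RHS]e.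
have gb : act g b = a i by have := ga i (ltnSn i); rewrite /c ltnn.
move=> SB lS; rewrite -gb; apply: (I_large hP (AB i) SB lS).
exact: (I_aut hP (AB i)).
Qed.

End Final.

End Locus.

(** * Left and right types *)

Lemma defin2_flip (L : language) (M : structure L) (G : seq (srt L)) (B : params M)
    (r : tup M G -> tup M G -> Prop) : defin2 B r -> defin2 B (flip r).
Proof. by move=> h; rewrite /flip; dfn. Qed.

Section Types.
Variables (L : language) (M : structure L) (K : Type) (hM : monster M K).
Variables (A : params M) (hA : small K (par A)) (G : seq (srt L)).
Variables (p : set (lform A (var G))) (hp : complete_type p).
Local Notation X := (tup M G).
Local Notation pC := (realizations p).
Implicit Types (o lt : X -> X -> Prop) (S : set X).

(** An initial part contains everything below any of its points, so initial parts of the form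
    [x <= c] suffice. *)
Lemma left_typeE lt phi : linear_order_on pC lt ->
  left_type p lt phi <-> large lt pC (solutions phi).
Proof.
move=> [irr tr tot]; split=> [[F [FP [c Fc] Fd] FS]|[c Pc cS]].
  exists c; first exact: FP.
  by move=> x Px [->|xc]; apply: FS => //; apply: Fd xc.
exists [set x | pC x /\ leo lt x c]; last by move=> x [Px]; apply: cS.
split; [by move=> x []|by exists c; split=> //; left|].
move=> x y [Px xc] Py yx; split=> //; right.
by case: xc => [<-//|xc]; apply: (tr y x c).
Qed.

Lemma right_typeE lt phi : linear_order_on pC lt ->
  right_type p lt phi <-> large (flip lt) pC (solutions phi).
Proof. by move=> /linear_order_on_rev/left_typeE; apply. Qed.

Lemma type_aut g x : autfix A g -> pC x -> pC (act g x).
Proof.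
move=> gA Px phi pphi.
have SA : defin1 A (@solutions _ _ A G phi) by apply/defin1_formula; exists phi.
by apply/(defin1_aut x gA SA); apply: Px.
Qed.

Lemma type_conj x y : pC x -> pC y -> exists2 g, autfix A g & act g x = y.
Proof.
move=> Px Py; apply: (homogeneity hM hA) => S /defin1_formula[phi ->] Sx.
case: (hp.2 phi) => h; first exact: Py.
by have := Px _ h Sx.
Qed.

Lemma type_ne : pC !=set0.
Proof. by apply: (monster_sat hM hA); case: hp. Qed.

Lemma type_td x : (forall S, defin1 A S -> pC `<=` S -> S x) -> pC x.
Proof.
move=> h phi pphi; apply: (h (solutions phi)); last by move=> y; apply.
by apply/defin1_formula; exists phi.
Qed.

Lemma pair_dich lt S : weakly_o_minimal_pair p lt -> defin1 (allparams M) S ->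
  finconv pC lt (S `&` pC).
Proof.
move=> [_ _ wom] /defin1_formula[phi ->].
have [|n [C [CC e]]] := wom (solutions phi `&` pC); first by exists (allparams M), phi.
by exists n, C.
Qed.

(* The left type of (p, o) is the left or the right type of (p, lt): it is an
   A-invariant global type extending p. *)
Lemma large_cases o lt r : linear_order_on pC o -> linear_order_on pC lt ->
  (forall S, defin1 (allparams M) S -> finconv pC o (S `&` pC)) ->
  (forall S, defin1 (allparams M) S -> finconv pC lt (S `&` pC)) ->
  defin2 A r -> (forall x y, pC x -> pC y -> (o x y <-> r x y)) ->
  defin2 A lt ->
  (forall S, defin1 (allparams M) S -> (large o pC S <-> large lt pC S)) \/
  (forall S, defin1 (allparams M) S -> (large o pC S <-> large (flip lt) pC S)).
Proof.
move=> lino linl womo woml rA ro ltA.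
have not_both o' S : linear_order_on pC o' -> large o' pC S -> large o' pC (~` S) -> False.
  move=> lo h h'; have [c Pc cS] := large_and lo (@subset_refl _ _) h h'.
  by have [] := cS c Pc (or_introl erefl).
(* Both notions of largeness behave like ultrafilters on definable sets, so one implication gives
   equivalence. *)
have key o' : linear_order_on pC o' ->
    (forall S, defin1 (allparams M) S -> large o' pC S \/ large o' pC (~` S)) ->
    (forall S, defin1 (allparams M) S -> large o' pC S -> large o pC S) ->
    forall S, defin1 (allparams M) S -> (large o pC S <-> large o' pC S).
  move=> lo dich h S SM; split; last exact: h.
  move=> oS; case: (dich S SM) => // /(h _ (defin_not SM)) oS'.
  by case: (not_both o S).
have sub S S' : S `&` pC `<=` S' -> large o pC S -> large o pC S'.
  by move=> SS [c Pc cS]; exists c => // x Px xc; apply: SS; split=> //; apply: cS.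
have belowM a : defin1 (allparams M) (fun x => lt x a).
  have ltM := defin_any ltA; by dfn.
have dich o' : linear_order_on pC o' ->
    (forall S, defin1 (allparams M) S -> finconv pC o' (S `&` pC)) ->
    forall S, defin1 (allparams M) S -> large o' pC S \/ large o' pC (~` S).
  move=> lo w S SM; apply: (large_dich lo _ _ type_ne (w S SM)); exact: subset_refl.
(* Either all lower rays of [lt] are large for [o], or by homogeneity none is, and then the
   complementary upper rays are. *)
case: (EM (forall a, pC a -> large o pC (fun x => lt x a))) => [hb|nb].
  left; apply: key => //; first exact: dich.
  move=> S SM [c Pc cS]; apply: sub (hb c Pc) => x [xc Px].
  by apply: cS => //; right.
have nb' a : pC a -> ~ large o pC (fun x => lt x a).
  move=> Pa h; apply: nb => b Pb; have [g gA <-] := type_conj Pa Pb.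
  have [g' [gA' gg' g'g]] := autfix_inv G gA.
  have [c Pc cS] := h; exists (act g c); first exact: type_aut.
  move=> x Px xc; rewrite -[x]g'g; apply/(defin2_aut _ _ gA ltA); apply: cS.
    exact: type_aut.
  case: xc => [->|xc]; first by rewrite gg'; left.
  right; apply/ro => //; first exact: type_aut.
  rewrite -[c]gg'; apply/(defin2_aut _ _ gA' rA); apply/ro => //.
  exact: type_aut.
right; apply: key.
- exact: linear_order_on_rev.
- by apply: dich => [|S SM]; [apply: linear_order_on_rev|apply: finconv_rev; apply: woml].
move=> S SM [c Pc cS].
case: (dich o lino womo _ (belowM c)) => [/(nb' _ Pc)//|].
apply: sub => x [xc Px]; apply: cS => //.
have [_ _ tot] := linl.
by case: (tot x c Px Pc) => [/xc//|->|]; [left|right].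
Qed.

Definition definable_large o := forall (D : seq (srt L))
    (phi : formula (fsum (var G) (var D))),
  definable [set b : tup M D | large o pC (solutions (instantiate phi b))].

Lemma definable_left lt : linear_order_on pC lt ->
  definable_type (left_type p lt) <-> definable_large lt.
Proof.
move=> lin; have e : left_type p lt = [set phi | large lt pC (solutions phi)].
  by apply/seteqP; split=> phi /=; rewrite left_typeE.
by rewrite e.
Qed.

Lemma definable_right lt : linear_order_on pC lt ->
  definable_type (right_type p lt) <-> definable_large (flip lt).
Proof. by move=> /linear_order_on_rev/definable_left. Qed.

Lemma definable_large_eq o o' :
  (forall S, defin1 (allparams M) S -> (large o pC S <-> large o' pC S)) ->
  definable_large o <-> definable_large o'.
Proof.
move=> h; have e D (phi : formula (fsum (var G) (var D))) :
    [set b : tup M D | large o pC (solutions (instantiate phi b))] =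
    [set b : tup M D | large o' pC (solutions (instantiate phi b))].
  by apply/seteqP; split=> b /=; apply h; apply/defin1_formula;
    exists (instantiate phi b).
by split=> H D phi; have := H D phi; rewrite e.
Qed.

Lemma instantiateE (D : seq (srt L)) (phi : formula (fsum (var G) (var D)))
    (b : tup M D) (x : X) :
  solutions (instantiate phi b) x <-> sat (asum x b) phi.
Proof.
rewrite /solutions /asat /= sat_rename.
by set a := acomp _ _; have -> : a = asum x b by apply: dfunext2 => s [].
Qed.

(** With [pC] definable, largeness becomes a first-order condition: some [c] in [pC] bounds an
    initial part on which [phi] holds. Applied to the reversed order, this turns a non-definable
    right type into a non-definable [pC]. *)
Lemma definable_large_of_definable lt : linear_order_on pC lt -> defin2 A lt ->
  defin1 (allparams M) pC -> definable_large lt.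
Proof.
move=> lin ltA /defin1_formula[chi chiP] D phi.
have [lf lfP] : exists lf : formula (fsum (fsum (var G) (var G)) (par (allparams M))),
    forall x y, lt x y <-> sat (asum (asum x y) (fun s (z : par (allparams M) s) => sval z)) lf.
  have [f fP] := defin_any ltA.
  pose h : assign (fsum (evar G) (par (allparams M)))
     (fsum (fsum (var G) (var G)) (par (allparams M))) := fun s v => match v with
     | inl (0, w) => inl (inl w) | inl (_, w) => inl (inr w) | inr z => inr z end.
  exists (rename h f) => x y; rewrite sat_rename.
  have := fP (fun i => if i is 0 then x else y); rewrite /asat /= => ->.
  by set a := asum _ _; set b := acomp _ _; have -> : a = b
    by apply: dfunext2 => s [[[|n] w]|z].
pose V := fsum (var D) (par (allparams M)).
pose val_ s (z : par (allparams M) s) := sval z.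
pose chic : formula (fsum V (var G)) := rename (fun s v => match v with
  | inl w => inr w | inr z => inl (inr z) end) chi.
have chicE b c : sat (asum (asum b val_) c) chic <-> pC c.
  rewrite chiP /chic sat_rename /solutions /asat /=.
  by set a := acomp _ _; set a' := asum _ _; have -> : a = a' by apply: dfunext2 => s [].
pose chix : formula (fsum (fsum V (var G)) (var G)) := rename (fun s v => match v with
  | inl w => inr w | inr z => inl (inl (inr z)) end) chi.
have chixE b c x : sat (asum (asum (asum b val_) c) x) chix <-> pC x.
  rewrite chiP /chix sat_rename /solutions /asat /=.
  by set a := acomp _ _; set a' := asum _ _; have -> : a = a' by apply: dfunext2 => s [].
pose ltcx : formula (fsum (fsum V (var G)) (var G)) := rename (fun s v => match v with
  | inl (inl w) => inl (inr w) | inl (inr w) => inr w | inr z => inl (inl (inr z)) end) lf.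
have ltcxE b c x : sat (asum (asum (asum b val_) c) x) ltcx <-> lt c x.
  rewrite lfP /ltcx sat_rename.
  by set a := acomp _ _; set a' := asum _ _; have -> : a = a' by apply: dfunext2 => s [[]|].
pose phix : formula (fsum (fsum V (var G)) (var G)) := rename (fun s v => match v with
  | inl w => inr w | inr z => inl (inl (inl z)) end) phi.
have phixE b c x : sat (asum (asum (asum b val_) c) x) phix <-> sat (asum x b) phi.
  rewrite /phix sat_rename.
  by set a := acomp _ _; set a' := asum _ _; have -> : a = a' by apply: dfunext2 => s [].
have [psi1 psi1P] := sat_forall_tuple M (FImp chix (FImp (FNot ltcx) phix)).
have [psi2 psi2P] := sat_forall_tuple M (FImp chic (FNot psi1)).
exists (allparams M), (FNot psi2); apply/seteqP.
have E b c : sat (asum (asum b val_) c) psi1 <->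
    forall x, pC x -> ~ lt c x -> sat (asum x b) phi.
  rewrite psi1P; split=> h x.
    move=> Px nl; apply/(phixE b c x); apply: (h x); first exact/chixE.
    by move=> lcx; apply/nl/(ltcxE b c x).
  move=> /(chixE b c x) Px nl; apply/phixE; apply: h => // lcx.
  by apply: nl; apply/(ltcxE b c x).
have F b : sat (asum b val_) (FNot psi2) <-> large lt pC (solutions (instantiate phi b)).
  change ((sat (asum b val_) psi2 -> False) <-> large lt pC (solutions (instantiate phi b))).
  rewrite psi2P; split=> [h|[c Pc cS] h].
    apply: contrapT => n; apply: h => c /= /chicE Pc /E hc; apply: n; exists c => // x Px xc.
    apply/instantiateE; apply: hc => // cx.
    exact: (lt_nle lin Pc Px cx xc).
  apply: (h c); first exact/chicE.
  apply/E => x Px ncx; apply/instantiateE; apply: cS => //.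
  exact: (nlt_le lin).
by split=> b /F.
Qed.

(** The definition of p_l is applied to the formula [~ y < x]. A definition scheme takes a finite
    tuple of parameter variables, so [formula_supp] first gathers [y] and the names from [A] in a
    context [D]. *)
Lemma left_cut_definable lt (la : lform A (fsum (var G) (var G))) : lt = rel_of la ->
  definable_large lt -> defin1 (allparams M) (fun y => large lt pC (fun x => ~ lt y x)).
Proof.
move=> ltE dl.
pose W := fsum (var G) (par A).
(* The formula says that [~ y < x], with x first and y among the parameters. *)
pose phi : formula (fsum (var G) W) := FNot (rename (fun s v => match v with
  | inl (inl w) => inr (inl w) | inl (inr w) => inl w | inr z => inr (inr z) end) la).
have [D [h [phi' hP]]] := formula_supp M phi.
pose phi'' : formula (fsum (var G) (var D)) := rename (fun s v => match h s v with
  | inl u => inl u | inr _ => inr v end) phi'.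
(* On variables that stand for [x] the value is a default: [phi''] reads these from [x] itself. *)
pose b (y : X) : tup M D := fun s v => match h s v with
  | inl u => y s u | inr (inl u) => y s u | inr (inr z) => sval z end.
have bP y x : solutions (instantiate phi'' (b y)) x <-> ~ lt y x.
  rewrite instantiateE /phi'' sat_rename.
  have -> : ~ lt y x <-> sat (asum x (asum y (fun s (z : par A s) => sval z))) phi.
    rewrite /phi /= sat_rename ltE /rel_of /asat.
    by set a := asum _ _; set a' := acomp _ _; have -> : a = a'
      by apply: dfunext2 => s [[]|].
  rewrite hP; set a := acomp _ _; set a' := acomp _ _.
  have -> // : a = a'; apply: dfunext2 => s v; rewrite /a /a' /acomp.
  case e : (h s v) => [u|w] //=; rewrite /b e.
  by case: w {e}.
have [B [psi psiP]] := dl D phi''.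
have QB y : large lt pC (fun x => ~ lt y x) <-> asat (b y) psi.
  have e : large lt pC (solutions (instantiate phi'' (b y))) <-> asat (b y) psi.
    change ([set b : tup M D | large lt pC (solutions (instantiate phi'' b))] (b y)
      <-> solutions psi (b y)).
    by rewrite psiP.
  rewrite -e; split=> -[c Pc cS]; exists c => // x Px xc; [apply/bP|apply/(bP y x)];
    exact: cS.
pose f : assign (fsum (var D) (par B)) (fsum (evar G) (par (allparams M))) :=
  fun s v => match v with
  | inl v => match h s v with
    | inl u => inl (0, u) | inr (inl u) => inl (0, u)
    | inr (inr z) => inr (exist (allparams M s) (sval z) I) end
  | inr z => inr (exist (allparams M s) (sval z) I) end.
exists (rename f psi) => e; rewrite QB /asat sat_rename.
set a := asum _ _; set a' := acomp _ _.
have -> // : a = a'; apply: dfunext2 => s [v|z] //=.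
by rewrite /a' /acomp /f /= /b; case: (h s v) => [u|[u|z]].
Qed.

End Types.

(** * The locus of the type, and the choice of the order *)

Section Main.
Variables (L : language) (M : structure L) (K : Type) (hM : monster M K).
Variables (A : params M) (hA : small K (par A)) (G : seq (srt L)).
Variables (p : set (lform A (var G))) (hp : complete_type p).
Local Notation X := (tup M G).
Local Notation pC := (realizations p).

Lemma toglobalE B (phi : lform B (var G)) :
  solutions (toglobal phi) = solutions phi :> set X.
Proof.
by apply/seteqP; split=> x; rewrite /solutions /asat /= sat_rename;
  congr sat; apply: dfunext2 => s [].
Qed.

Lemma rel_of_flip (la : lform A (fsum (var G) (var G))) :
  exists la' : lform A (fsum (var G) (var G)), rel_of la' = flip (rel_of la).
Proof.
exists (rename (fun s v => match v with
  | inl (inl w) => inl (inr w) | inl (inr w) => inl (inl w) | inr z => inr z end) la).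
apply: funext => x; apply: funext => y; apply: propext.
rewrite /flip /rel_of /asat sat_rename.
set a := acomp _ _; set b := asum _ _.
by have -> : a = b by apply: dfunext2 => s [[]|].
Qed.

Lemma trivial_of_left (la : lform A (fsum (var G) (var G))) (theta : lform A (var G)) :
  p theta -> linear_order_on (solutions theta) (rel_of la) ->
  convex_in (solutions theta) (rel_of la) pC ->
  (forall S, defin1 (allparams M) S -> finconv pC (rel_of la) (S `&` pC)) ->
  definable_large p (rel_of la) -> ~ definable_large p (flip (rel_of la)) ->
  trivial_type p.
Proof.
move=> ptheta lin [pD cvx] wom dl ndr.
set lt := rel_of la in lin cvx wom dl ndr.
set D := solutions theta in lin pD cvx.
have ltA : defin2 A lt by apply: defin2_rel_of.
have DA : defin1 A D by apply/defin1_formula; exists theta.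
have linp := linear_order_on_sub pD lin.
have ndp : ~ defin1 (allparams M) pC.
  move=> dp; apply: ndr; apply: definable_large_of_definable => //.
    exact: linear_order_on_rev.
  exact: defin2_flip.
pose Q y := large lt pC (fun x => ~ lt y x).
have QM : defin1 (allparams M) Q by apply: (@left_cut_definable _ _ _ _ _ lt la).
have pQ : pC `<=` Q.
  by move=> y Py; exists y => // x Px xy yx; apply: (lt_nle linp Py Px yx xy).
have [S [SA pS SQ]] := td_compact hM hA (@type_td _ _ _ _ p) QM pQ.
(* By [SQ], each element of [E] is at or above some realization of [p]; convexity in [D] then makes
   [pC] initial in [E]. *)
pose E y := D y /\ exists c, (D c /\ S c) /\ ~ lt y c.
have hP : locus K A lt D pC A E pC.
  split=> //.
  - by move=> s x.
  - by rewrite /E; dfn.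
  - by move=> y [].
  - move=> y Py; split; first exact: pD.
    exists y; split; first by split; [apply: pD|apply: pS].
    by apply: (lt_irr lin); apply: pD.
  - move=> x y Px [Dy [c [[Dc /SQ[c' Pc' hc']] yc]]] yx.
    have Dc' := pD _ Pc'.
    have c'c : leo lt c' c by apply: (nlt_le lin) => //; apply: hc' => //; left.
    have := le_tr lin Dc' Dc Dy c'c (nlt_le lin Dy Dc yc).
    by case=> [<-//|c'y]; apply: (cvx c' y x).
  - exact: (type_ne hM hA hp).
  - exact: type_td.
  - exact: (type_conj hM hA hp).
(* Triviality is expressed by right types, and the sequences studied above descend: p_l is the right
   type of the reversed order. *)
exists (flip lt); split.
  split; last first.
  - move=> Y [B [phi ->]].
    have [|n [C [CC e]]] := finconv_rev (wom (solutions phi) _).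
      by apply: (@defin_any _ _ _ B); apply/defin1_formula; exists phi.
    by exists n, C.
  - exact: linear_order_on_rev.
  - have [la' e] := rel_of_flip la; exists la' => x y Px Py.
    by rewrite e.
have rE phi : right_type p (flip lt) phi <-> large lt pC (solutions phi).
  exact: right_typeE (linear_order_on_rev linp).
move=> a aP aT i phi /rE; rewrite toglobalE => lphi.
apply: (pairwise_morley hM ltA lin pD wom hP aP _ _ lphi); last first.
  by apply/defin1_formula; exists phi.
move=> j k jk Y /defin1_formula[chi ->] lchi; have [_ _ h] := aT j k jk.
by apply: h; apply/rE; rewrite toglobalE.
Qed.

End Main.

Theorem proposition5p15 (L : language) (M : structure L) (K : Type)
    (hM : monster M K) (A : params M) (hA : small K (par A))
    (G : seq (srt L)) (p : set (lform A (var G))) (hp : complete_type p)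
    (hw : weakly_o_minimal p) (hconv : convex_type p) (hmix : mixed_kind p) :
  trivial_type p.
Proof.
have [lt0 [w0 [la [la0 [theta [ptheta lin cvx]]]]]] := hconv.
have [lt1 [w1 mix]] := hmix.
have pD := cvx.1; have linp := linear_order_on_sub pD lin.
have [[la1 la1E] lin1 _] := w1.
have wom S : defin1 (allparams M) S ->
    finconv (realizations p) (rel_of la) (S `&` realizations p).
  move=> /(pair_dich w0)[n [C [CC e]]]; exists n, C; split=> // i.
  have [Cp cC] := CC i; split=> // x y z Cx Cz Py /la0 xy /la0 yz.
  by apply: (cC x y z) => //; [apply: xy|apply: yz] => //; apply: Cp.
have wom1 S : defin1 (allparams M) S ->
    finconv (realizations p) lt1 (S `&` realizations p) by exact: pair_dich.
have laA := defin2_rel_of la; have la1A := defin2_rel_of la1.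
(* The order witnessing mixed kind may differ from the one witnessing convexity, so its left and
   right types are matched with those of [rel_of la]. *)
have cl := large_cases hM hA hp lin1 linp wom1 wom la1A la1E laA.
have cr : (forall S, defin1 (allparams M) S ->
      (large (flip lt1) (realizations p) S <-> large (rel_of la) (realizations p) S)) \/
    (forall S, defin1 (allparams M) S ->
      (large (flip lt1) (realizations p) S <->
       large (flip (rel_of la)) (realizations p) S)).
  apply: (large_cases hM hA hp (linear_order_on_rev lin1) linp
    (r := flip (rel_of la1))) => //.
  - by move=> S SM; apply: finconv_rev; apply: wom1.
  - exact: defin2_flip.
  - by move=> x y Px Py; apply: la1E.
have {mix} mix : definable_large p (rel_of la) /\ ~ definable_large p (flip (rel_of la)) \/
    ~ definable_large p (rel_of la) /\ definable_large p (flip (rel_of la)).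
  move: mix; rewrite (definable_left lin1) (definable_right lin1).
  (* If both types were matched with the same side, the hypothesis of mixed kind would be
     contradictory. *)
  by case: cl => /definable_large_eq ->; case: cr => /definable_large_eq ->; tauto.
case: mix => -[dl dr]; first exact: (trivial_of_left hM hA hp ptheta lin cvx).
have [la' e] := rel_of_flip la.
apply: (trivial_of_left hM hA hp (la := la') ptheta); rewrite e.
- exact: linear_order_on_rev.
- have [_ cv] := cvx; split=> // x y z Px Pz Dy xy yz.
  exact: (cv z y x).
- by move=> S /wom/finconv_rev.
- by [].
- by [].
Qed.
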